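(* Let $\Gamma$ be a countable discrete group, let $\mu\in\mathrm{Prob}(\Gamma)$, and suppose $\Gamma$ admits an essentially free $\mu$-boundary which has a compact model that is uniquely $\mu$-stationary. Then a measurable $\mu$-stationary action $\Gamma\curvearrowright(X,\nu)$ is essentially free if its restriction to some co-amenable subgroup $\Lambda\leq\Gamma$ is essentially free.
   Context: Measurable actions $\Gamma\curvearrowright(Y,\eta)$ on probability spaces are assumed non-singular; such an action is $\mu$-stationary if $\sum_g\mu(g)\,g\eta=\eta$, and an action of a group is essentially free if $\eta(\{y:gy=y\})=0$ for every $g\neq e$ in the group. A compact model of $(Y,\eta)$ is a compact Hausdorff space $K$ with an action of $\Gamma$ by homeomorphisms and a Borel probability measure $\bar\nu$ such that $(K,\bar\nu)\cong(Y,\eta)$ as measurable $\Gamma$-spaces; it is uniquely $\mu$-stationary if $\bar\nu$ is the unique $\mu$-stationary Borel probability measure on $K$. Let $\omega_k=g_1\cdots g_k$ with $g_i$ i.i.d. of law $\mu$. A compact metrizable $\Gamma$-space $Z$ with a $\mu$-stationary Borel probability measure $\zeta$ is a $\mu$-boundary if for almost every path $\omega_k\zeta$ converges weak* to a Dirac measure; a measurable $\mu$-stationary action is a $\mu$-boundary if it has a compact metrizable model that is a $\mu$-boundary. A subgroup $\Lambda\leq\Gamma$ is co-amenable if every continuous affine action of $\Gamma$ on a non-empty compact convex set with a $\Lambda$-fixed point has a $\Gamma$-fixed point. *)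

(* Defs.v *)
From HB Require Import structures.
From mathcomp Require Import all_boot all_order all_algebra.
From mathcomp Require Import all_classical all_reals all_analysis.

Set Implicit Arguments.
Unset Strict Implicit.
Unset Printing Implicit Defensive.

Import Order.TTheory GRing.Theory Num.Theory.
Import numFieldNormedType.Exports.

Local Open Scope classical_set_scope.
Local Open Scope ring_scope.

Notation borel T := (g_sigma_algebraType (@open T)).

Section actions.
Variables (R : realType) (G : groupType).

Definition prob_on_group (mu : G -> R) : Prop :=
  (forall g, 0 <= mu g) /\ \esum_(g in [set: G]) (mu g)%:E = 1%E.

Definition is_action (T : Type) (a : G -> T -> T) : Prop :=
  (forall x, a 1%g x = x) /\ (forall g h x, a (g * h)%g x = a g (a h x)).

Definition measurable_action d (T : measurableType d)
    (a : G -> T -> T) (eta : probability T R) : Prop :=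
  [/\ is_action a,
      (forall g, measurable_fun [set: T] (a g)) &
      (forall g A, measurable A ->
         (pushforward eta (a g) A = 0%E <-> eta A = 0%E))].

(* [pushforward eta (a g)] is the translate g eta : A |-> eta (g^-1 A). *)
Definition stationary (mu : G -> R) d (T : measurableType d)
    (a : G -> T -> T) (eta : probability T R) : Prop :=
  forall A, measurable A ->
    (\esum_(g in [set: G]) ((mu g)%:E * pushforward eta (a g) A))%E = eta A.

(* Essential freeness of the restriction of the action to [L]; take
   [L := [set: G]] for the whole group.  [negligible] (contained in a
   measurable null set) agrees with "measure zero" on measurable sets; a
   measure of the library is unconstrained on non-measurable sets. *)
Definition essentially_free (L : set G) d (T : measurableType d)
    (a : G -> T -> T) (eta : probability T R) : Prop :=
  forall g, L g -> g <> 1%g -> eta.-negligible [set x | a g x = x].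

(* [essentially_free] is only meaningful for actions whose fixed-point sets are
   events, which is automatic on standard Borel spaces (more generally, when
   the sigma-algebra is countably separated) but not on arbitrary ones. *)
Definition measurable_fixpoints d (T : measurableType d)
    (a : G -> T -> T) : Prop :=
  forall g, measurable [set x | a g x = x].

(* Isomorphism of measurable G-spaces, i.e. modulo null sets: [f] and [h] are
   defined everywhere, but are mutually inverse and equivariant only almost
   everywhere. *)
Definition measurably_isomorphic d1 (Y : measurableType d1) (a : G -> Y -> Y)
    (eta : probability Y R) d2 (K : measurableType d2) (b : G -> K -> K)
    (nu : probability K R) : Prop :=
  exists (f : Y -> K) (h : K -> Y),
    [/\ measurable_fun [set: Y] f /\ measurable_fun [set: K] h,
        (forall A, measurable A -> pushforward eta f A = nu A),
        {ae eta, forall y, h (f y) = y},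
        {ae nu, forall k, f (h k) = k} &
        {ae eta, forall y, forall g, f (a g y) = b g (f y)}].

(* Borel probability measures on compact Hausdorff spaces are understood, as
   usual (Riesz), to be regular; this is automatic on metrizable spaces.  On a
   non-metrizable K, a measure which is the unique stationary one among *all*
   Borel probability measures is also regular, since a regular stationary
   measure always exists, so the convention only enlarges the class of uniquely
   stationary models. *)
Definition regular_borel (K : ptopologicalType)
    (nu : probability (borel K) R) : Prop :=
  forall A : set (borel K), measurable A ->
    nu A = ereal_sup [set nu C | C in [set C : set K | compact C /\ C `<=` A]]
    /\
    nu A = ereal_inf [set nu U | U in [set U : set K | open U /\ A `<=` U]].

Definition compact_space_action (K : ptopologicalType)
    (b : G -> K -> K) : Prop :=
  [/\ compact [set: K], hausdorff_space K, is_action b &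
      forall g, continuous (b g)].

Definition compact_model d (Y : measurableType d) (a : G -> Y -> Y)
    (eta : probability Y R) (K : ptopologicalType) (b : G -> K -> K)
    (nu : probability (borel K) R) : Prop :=
  [/\ compact_space_action b, regular_borel nu &
      @measurably_isomorphic _ Y a eta _ (borel K) b nu].

Definition uniquely_stationary (mu : G -> R) (K : ptopologicalType)
    (b : G -> K -> K) (nu : probability (borel K) R) : Prop :=
  @stationary mu _ (borel K) b nu /\
  forall nu' : probability (borel K) R,
    regular_borel nu' -> @stationary mu _ (borel K) b nu' ->
    forall A : set (borel K), measurable A -> nu' A = nu A.

(* The increments [xi] are i.i.d. of law [mu].  As G will be countable, it is
   enough to give the joint law of (xi 0, ..., xi n.-1) on points of G^n. *)
Definition iid (mu : G -> R) d (Omega : measurableType d)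
    (P : probability Omega R) (xi : nat -> Omega -> G) : Prop :=
  (forall i s, measurable [set w | xi i w = s]) /\
  (forall n (s : 'I_n -> G),
     P [set w | forall i : 'I_n, xi i w = s i] = (\prod_(i < n) mu (s i))%:E).

(* omega_k = g_1 ... g_k; the increments are numbered from 0 here. *)
Definition walk (Omega : Type) (xi : nat -> Omega -> G) (w : Omega) (k : nat)
    : G := (\prod_(i < k) xi i w)%g.

Definition weak_star_cvg (Z : ptopologicalType)
    (P : nat -> set (borel Z) -> \bar R) (Q : set (borel Z) -> \bar R) : Prop :=
  forall f : Z -> R, continuous f ->
    (\int[P k]_(x in [set: borel Z]) (f x)%:E)%E @[k --> \oo] -->
    (\int[Q]_(x in [set: borel Z]) (f x)%:E)%E.

(* Whether almost every path has the required property depends only on [mu],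
   not on the probability space [Omega] carrying the i.i.d. increments. *)
Definition topological_mu_boundary (mu : G -> R) (Z : pseudoPMetricType R)
    (b : G -> Z -> Z) (zeta : probability (borel Z) R) : Prop :=
  [/\ compact_space_action b, @stationary mu _ (borel Z) b zeta &
      exists d (Omega : measurableType d) (P : probability Omega R)
        (xi : nat -> Omega -> G),
        iid mu P xi /\
        {ae P, forall w, exists z : Z,
          weak_star_cvg
            (fun k => @pushforward _ _ (borel Z) (borel Z) R
                        zeta (b (walk xi w k)))
            (@dirac _ (borel Z) z R)}].

(* A Hausdorff pseudometric space is a metric space. *)
Definition mu_boundary (mu : G -> R) d (Y : measurableType d)
    (a : G -> Y -> Y) (eta : probability Y R) : Prop :=
  [/\ measurable_action a eta, stationary mu a eta &
      exists (Z : pseudoPMetricType R) (b : G -> Z -> Z)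
        (zeta : probability (borel Z) R),
        compact_model a eta b zeta /\ topological_mu_boundary mu b zeta].

Definition subgroup (L : set G) : Prop := group_closed [in L].

(* A continuous affine action of G on the convex set [C]; [a g] is irrelevant
   outside [C]. *)
Definition affine_action_on (E : tvsType R) (C : set E)
    (a : G -> E -> E) : Prop :=
  [/\ (forall g x, C x -> C (a g x)),
      (forall x, C x -> a 1%g x = x) /\
      (forall g h x, C x -> a (g * h)%g x = a g (a h x)),
      (forall g, {within C, continuous (a g)}) &
      (forall g x y (t : R), C x -> C y -> 0 <= t -> t <= 1 ->
         a g (t *: x + (1 - t) *: y) = t *: a g x + (1 - t) *: a g y)].

(* [tvsType] is the type of locally convex topological vector spaces. *)
Definition coamenable (L : set G) : Prop :=
  forall (E : tvsType R) (C : set E) (a : G -> E -> E),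
    hausdorff_space E -> compact C -> convex_set C -> C !=set0 ->
    affine_action_on C a ->
    (exists x, C x /\ forall g, L g -> a g x = x) ->
    exists x, C x /\ forall g, a g x = x.

End actions.

(* Main.v *)
Require Import Defs.
From HB Require Import structures.
From mathcomp Require Import all_boot all_order all_algebra.
From mathcomp Require Import all_classical all_reals all_analysis.
From mathcomp Require Import measurable_realfun ring lra.

Set Implicit Arguments.
Unset Strict Implicit.
Unset Printing Implicit Defensive.

Import Order.TTheory GRing.Theory Num.Theory.
Import numFieldNormedType.Exports.

Local Open Scope classical_set_scope.
Local Open Scope ring_scope.

(** Since the conjugates of the co-amenable subgroup L meet the stabilizer H of
almost every x trivially, H acts freely on G/L.  A G-invariant mean on G/L
therefore pushes forward, along H-equivariant maps from G/L to G and an orbit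
map from G to K, to an H-invariant mean on the uniquely stationary model K.
Integrating over x and averaging along the random walk gives a stationary,
finitely additive joining of X and K whose fibre over x is invariant under the
stabilizer of x.  Regularizing its K-marginal yields a stationary regular Borel
measure, so that marginal is the given measure nuK, and the invariance of the
fibres says that, for every Borel set B,
  nu (Fix g) <= nuK (K \ B) + nuK (g^-1 B).
This inequality is transported to a metrizable model Z.  Applied to the
conjugates of g by the walk omega_k and to the omega_k-translates of a small
neighbourhood of the limit point z of the path, it shows that
nu (omega_k^-1 Fix g) tends to 0 unless g z = z; by stationarity its expectation
is nu (Fix g), while z is almost surely not fixed by g. *)

(** * The locally convex space of pointwise convergence *)

(** A separate name for [I -> R], so that the topology of pointwise convergence can be attached to
    the linear structure and give a [tvsType], as [coamenable] demands. *)
Definition ptws_space (I : Type) (R : realType) := I -> R.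

Section ptws_space.
Variables (I : Type) (R : realType).
Local Notation E := (ptws_space I R).

HB.instance Definition _ := GRing.Lmodule.copy E (I -> R).

(** The basic neighbourhoods. Coordinates are listed through [List.In] because [I] carries no
    decidable equality. *)
Definition ptws_box (f : E) (s : seq I) (e : R) : set E :=
  [set h | forall i, List.In i s -> `|h i - f i| < e].

Definition ptws_nbhs (f : E) : set_system E :=
  [set A | exists s e, 0 < e /\ ptws_box f s e `<=` A].

Lemma ptws_box_cat (f : E) s1 s2 e1 e2 h :
  ptws_box f (s1 ++ s2) (Num.min e1 e2) h ->
  ptws_box f s1 e1 h /\ ptws_box f s2 e2 h.
Proof.
move=> H; split=> i si; have := H i; rewrite lt_min => /(_ _)/andP[] //.
- by apply/List.in_or_app; left.
- by apply/List.in_or_app; right.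
Qed.

Lemma ptws_nbhs_filter f : ProperFilter (ptws_nbhs f).
Proof.
split; first by move=> [s [e [e0 /(_ f)]]]; apply => i _; rewrite subrr normr0.
split; first by exists [::], 1.
- move=> P Q [s1 [e1 [e10 H1]]] [s2 [e2 [e20 H2]]].
  exists (s1 ++ s2), (Num.min e1 e2); split; first by rewrite lt_min e10.
  by move=> h /ptws_box_cat[/H1 ? /H2].
- by move=> P Q PQ [s [e [e0 H]]]; exists s, e; split => // h /H /PQ.
Qed.

Lemma ptws_nbhs_singleton f A : ptws_nbhs f A -> A f.
Proof. by move=> [s [e [e0 /(_ f)]]]; apply => i _; rewrite subrr normr0. Qed.

(** The radius is the smallest slack [e - |h i - f i|] over the listed coordinates, found by
    induction on the list. This is what makes boxes open. *)
Lemma ptws_box_shrink (f h : E) s e : ptws_box f s e h ->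
  exists2 d, 0 < d & ptws_box h s d `<=` ptws_box f s e.
Proof.
elim: s => [|i s IH] H; first by exists 1 => // k _ j [].
have [d d0 Hd] : exists2 d, 0 < d & ptws_box h s d `<=` ptws_box f s e.
  by apply: IH => j sj; apply: H; right.
have ei : 0 < e - `|h i - f i| by rewrite subr_gt0; apply: H; left.
exists (Num.min d (e - `|h i - f i|)); first by rewrite lt_min d0.
move=> k hk j [<-|sj]; last first.
  by apply: Hd => // l sl; have := hk l; rewrite lt_min => /(_ _)/andP[] //; right.
have := hk i (or_introl erefl); rewrite lt_min => /andP[_].
rewrite ltrBrDr; apply: le_lt_trans.
by rewrite (_ : k i - f i = k i - h i + (h i - f i)) ?ler_normD//; ring.
Qed.

Lemma ptws_nbhs_nbhs f A : ptws_nbhs f A -> ptws_nbhs f (ptws_nbhs^~ A).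
Proof.
move=> [s [e [e0 H]]]; exists s, e; split => // h /ptws_box_shrink[d d0 hd].
by exists s, d; split => // k /hd /H.
Qed.

HB.instance Definition _ := hasNbhs.Build E ptws_nbhs.
HB.instance Definition _ := Nbhs_isNbhsTopological.Build E
  ptws_nbhs_filter ptws_nbhs_singleton ptws_nbhs_nbhs.

Lemma ptws_box_open f s e : open (ptws_box f s e : set E).
Proof. by rewrite openE => h /ptws_box_shrink[d d0 hd]; exists s, d. Qed.

Lemma ptws_proj_nbhs (f : E) (i : I) (e : R) :
  0 < e -> nbhs f [set h : E | `|h i - f i| < e].
Proof. by move=> e0; exists [:: i], e; split => // h; apply; left. Qed.

Lemma ptws_cvg (T : Type) (F : set_system T) (u : T -> E) (f : E) :
  Filter F ->
  (forall i e, 0 < e -> \forall x \near F, `|u x i - f i| < e) -> u @ F --> f.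
Proof.
move=> FF H A [s [e [e0 HA]]].
suff : F (u @^-1` ptws_box f s e) by apply: filterS => x /HA.
elim: s {HA} => [|i s IH]; first by apply: filterS filterT => x _ j [].
by apply: filterS2 IH (H i e e0) => x Hs Hi j [<-|/Hs].
Qed.

Lemma ptws_add_continuous : continuous (fun x : E * E => x.1 + x.2).
Proof.
move=> [f g]; apply: ptws_cvg => i e e0 /=.
have e20 : 0 < e / 2 by rewrite divr_gt0.
exists ([set h : E | `|h i - f i| < e / 2], [set h : E | `|h i - g i| < e / 2]).
  by split; exact: ptws_proj_nbhs.
move=> [h k] [/= hf kg].
have -> : (h + k) i - (f + g) i = (h i - f i) + (k i - g i).
  by rewrite -[(h + k) i]/(h i + k i) -[(f + g) i]/(f i + g i); ring.
by rewrite (le_lt_trans (ler_normD _ _))// (splitr e) ltrD.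
Qed.

Lemma ptws_scale_continuous : continuous (fun z : R^o * E => z.1 *: z.2).
Proof.
move=> [t f]; apply: ptws_cvg => i e e0 /=.
have : \forall z \near nbhs ((t, f i) : R^o * R^o),
    `|z.1 *: z.2 - t *: (f i : R^o)| < e.
  have /cvgrPdist_lt/(_ e e0) := @scale_continuous R R^o (t, f i).
  by apply: filterS => z; rewrite distrC.
move=> [[A B] [/= At Bf] AB].
exists (A, [set h : E | B (h i)]) => /=; last by move=> [r h] [/= Ar Bh]; exact: (AB (r, h i)).
split => //; move: Bf => /nbhs_ballP[d d0 Bd].
apply: filterS (ptws_proj_nbhs f i d0) => h /= hd; apply: Bd.
by rewrite -ball_normE /ball_/= distrC.
Qed.

Lemma ptws_locally_convex :
  exists2 B : set_system E, (forall b, b \in B -> convex_set b) & basis B.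
Proof.
exists [set b | exists f s e, b = ptws_box f s e].
  move=> b /[!inE] -[f [s [e ->]]] g h l /[!inE] /= gb hb i si.
  have gi := gb i si; have hi := hb i si.
  have -> : (conv l g h : I -> R) i - f i =
     l%:num * (g i - f i) + (1 - l%:num) * (h i - f i).
    rewrite -[(conv l g h : I -> R) i]/(l%:num * g i + (1 - l%:num) * h i).
    by ring.
  have l0 : 0 <= l%:num by []. have l1 : l%:num <= 1 by [].
  apply: le_lt_trans (ler_normD _ _) _; rewrite !normrM (ger0_norm l0) (@ger0_norm _ (1 - l%:num)) ?subr_ge0//.
  set m := Num.max `|g i - f i| `|h i - f i|.
  have me : m < e by rewrite gt_max gi.
  apply: le_lt_trans me; have -> : m = l%:num * m + (1 - l%:num) * m by ring.
  have gm : `|g i - f i| <= m by rewrite le_max lexx.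
  have hm : `|h i - f i| <= m by rewrite le_max lexx orbT.
  by apply: lerD; apply: ler_wpM2l => //; rewrite subr_ge0.
split; first by move=> b [f [s [e ->]]]; exact: ptws_box_open.
move=> f A [s [e [e0 H]]]; exists (ptws_box f s e) => //.
by split; [exists f, s, e|move=> i _; rewrite subrr normr0].
Qed.

HB.instance Definition _ := PreTopologicalLmod_isTvs.Build R E
  ptws_add_continuous ptws_scale_continuous ptws_locally_convex.

HB.instance Definition _ := PreTopologicalNmodule_isTopologicalNmodule.Build E
  ptws_add_continuous.
HB.instance Definition _ := TopologicalNmodule_isTopologicalLmodule.Build R E
  ptws_scale_continuous.
HB.instance Definition _ := Uniform_isTvs.Build R E ptws_locally_convex.

Lemma ptws_hausdorff : hausdorff_space E.
Proof.
move=> f g fg; apply/funext => i; apply/eqP; rewrite -subr_eq0 -normr_le0.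
rewrite leNgt; apply/negP => e0.
have e20 : 0 < `|f i - g i| / 2 by rewrite divr_gt0.
have [h [/= hf hg]] := fg _ _ (ptws_proj_nbhs f i e20) (ptws_proj_nbhs g i e20).
have : `|f i - g i| <= `|h i - f i| + `|h i - g i|.
  by rewrite (distrC (h i) (f i)); apply: le_trans (ler_normD _ _); rewrite addrA subrK.
by move: hf hg e0; set x := `|f i - g i|; lra.
Qed.

(** Tychonoff gives compactness in the product topology, and a cluster point there is one here since
    every box is a neighbourhood for the product. *)
Lemma ptws_compact (a b : I -> R) (P : set E) :
  (forall f, P f -> forall i, a i <= f i <= b i) ->
  @closed (prod_topology (fun _ : {classic I} => R)) P ->
  compact (P : set E).
Proof.
move=> Pab Pcl.
have : @compact (prod_topology (fun _ : {classic I} => R)) P.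
  apply: (@subclosed_compact (prod_topology (fun _ : {classic I} => R)) _
    [set f | forall i : {classic I}, [set` `[a i, b i]] (f i)]).
  - exact: Pcl.
  - apply: (@tychonoff {classic I} (fun=> R) (fun i => [set` `[a i, b i]])) => i.
    exact: segment_compact.
  - by move=> f Pf i /=; rewrite in_itv/=; exact: Pab.
move=> Pco F FF FP; have [f [Pf Ff]] := Pco F FF FP.
exists f; split => // A B FA [s [e [e0 sB]]]; apply: Ff => //.
apply: (@filterS (prod_topology (fun _ : {classic I} => R)) _ _ (ptws_box f s e)) => //.
elim: s {sB} => [|i s IH]; first by apply: filterS filterT => x _ j [].
have Hi : @nbhs _ (prod_topology (fun _ : {classic I} => R)) f
    [set h | ball (f i) e (h i)].
  exact: (@proj_continuous {classic I} (fun=> R) i f _ (nbhsx_ballx (f i) e e0)).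
apply: filterS2 IH Hi => h hs hi j [<-|/hs//].
by rewrite distrC; move: hi; rewrite /= -ball_normE.
Qed.

End ptws_space.

(** * An invariant mean on the cosets of a co-amenable subgroup *)

Section mean.
Variables (R : realType) (G : groupType) (L : set G).

(** Functions from G/L to [0,1], represented by functions on [G] invariant under right translation
    by [L]. *)
Definition coset_weight (phi : G -> R) : Prop :=
  (forall g, 0 <= phi g <= 1) /\ (forall g l, L l -> phi (g * l)%g = phi g).

(** A finitely additive mean on G/L, seen only on functions with values in [0,1]; additivity is
    therefore restricted to sums that stay in this range. *)
Record coset_mean (m : (G -> R) -> R) : Prop := CosetMean {
  coset_mean_ge0 : forall phi, coset_weight phi -> 0 <= m phi;
  coset_meanD : forall phi psi, coset_weight phi -> coset_weight psi ->
    coset_weight (phi \+ psi) -> m (phi \+ psi) = m phi + m psi;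
  coset_mean_cst : forall r : R, 0 <= r <= 1 -> m (fun=> r) = r }.

Lemma coset_weight_shift g phi :
  coset_weight (fun x => phi (g * x)%g) <-> coset_weight phi.
Proof.
split=> -[H1 H2]; split=> x.
- by have := H1 (g^-1 * x)%g; rewrite mulVKg.
- by move=> l Ll; have := H2 (g^-1 * x)%g l Ll; rewrite -mulgA !mulVKg.
- exact: H1.
- by move=> l Ll; rewrite mulgA; exact: H2.
Qed.

Lemma coset_mean_le m phi psi : coset_mean m ->
  coset_weight phi -> coset_weight psi -> (forall x, phi x <= psi x) ->
  m phi <= m psi.
Proof.
move=> [m0 mD _] Hphi Hpsi phipsi.
have Hd : coset_weight (fun x => psi x - phi x).
  split=> [x|x l Ll /=]; last by rewrite Hphi.2// Hpsi.2.
  have /andP[? ?] := Hphi.1 x; have /andP[? ?] := Hpsi.1 x; have ? := phipsi x.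
  by apply/andP; split; lra.
have E : phi \+ (fun x => psi x - phi x) = psi.
  by apply/funext => x /=; ring.
by rewrite -E mD// ?E// lerDl m0.
Qed.

(** Upper end of the segment allowed for [m phi]. Forcing the value 0 off the coset weights puts [C]
    inside a product of compact segments. *)
Let supp (phi : G -> R) : R := if `[< coset_weight phi >] then 1 else 0.

Let C : set (ptws_space (G -> R) R) := [set m | coset_mean m /\
  forall phi, 0 <= m phi <= supp phi].

Let act (g : G) (m : ptws_space (G -> R) R) : ptws_space (G -> R) R :=
  fun phi => m (fun x => phi (g * x)%g).

Let actC g m : C m -> C (act g m).
Proof.
move=> [[m0 mD m1] mB]; split.
  split=> [phi Hphi|phi psi Hphi Hpsi Hs|r r01].
  - by apply: m0; apply/coset_weight_shift.
  - apply: mD; first by apply: (proj2 (coset_weight_shift g phi)).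
      by apply: (proj2 (coset_weight_shift g psi)).
    by apply: (proj2 (coset_weight_shift g (phi \+ psi))).
  - exact: m1.
move=> phi; suff <- : supp (fun x => phi (g * x)%g) = supp phi by exact: mB.
rewrite /supp; congr (if _ then _ else _).
by congr asbool; apply/propext; exact: coset_weight_shift.
Qed.

Let act_continuous g : continuous (act g).
Proof.
move=> m; apply: (@ptws_cvg _ _ _ (nbhs m) (act g) (act g m)) => phi e e0.
exact: (ptws_proj_nbhs m (fun x => phi (g * x)%g) e0).
Qed.

Let continuous_subD (T : topologicalType) (f g h : T -> R) :
  continuous f -> continuous g -> continuous h ->
  continuous (fun x => f x - (g x + h x)).
Proof. by move=> cf cg ch x; apply: cvgB; [exact: cf|apply: cvgD]; [exact: cg|exact: ch]. Qed.

Let compactC : compact C.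
Proof.
apply: (@ptws_compact _ _ (fun=> 0) supp) => [m [_ mB] phi|]; first exact: mB.
pose P := prod_topology (fun _ : {classic (G -> R)} => R).
have ev (phi : G -> R) : continuous (fun m : P => m phi).
  exact: (@proj_continuous {classic (G -> R)} (fun=> R) phi).
have evge (f : P -> R) : continuous f -> closed [set m | 0 <= f m].
  move=> cf; apply: (@closed_comp P R f [set x | 0 <= x]); last exact: closed_ge.
  by move=> m _; exact: cf.
have evle (f : P -> R) c : continuous f -> closed [set m | f m <= c].
  move=> cf; apply: (@closed_comp P R f [set x | x <= c]); last exact: closed_le.
  by move=> m _; exact: cf.
have eveq (f : P -> R) c : continuous f -> closed [set m | f m = c].
  move=> cf; apply: (@closed_comp P R f [set x | x = c]); last exact: closed_eq.
  by move=> m _; exact: cf.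
(* Each defining condition of [C] involves finitely many evaluations, so [C] is an intersection of
   closed sets. *)
rewrite (_ : C =
  (\bigcap_(phi in [set: G -> R]) ([set m : P | 0 <= m phi] `&`
                                   [set m : P | m phi <= supp phi])) `&`
  ((\bigcap_(u in [set u : (G -> R) * (G -> R) | [/\ coset_weight u.1,
      coset_weight u.2 & coset_weight (u.1 \+ u.2)]])
    [set m : P | m (u.1 \+ u.2) - (m u.1 + m u.2) = 0]) `&`
  (\bigcap_(r in [set r : R | 0 <= r <= 1]) [set m : P | m (fun=> r) = r]))).
  apply: closedI.
    by apply: closed_bigI => phi _; apply: closedI; [exact: evge|exact: evle].
  apply: closedI.
    apply: closed_bigI => u _; apply: eveq.
    exact: (continuous_subD (ev (u.1 \+ u.2)) (ev u.1) (ev u.2)).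
  by apply: closed_bigI => r _; exact: eveq.
apply/seteqP; split=> m /=.
  move=> [[m0 mD m1] mB]; split; first by move=> phi _; split; have /andP[] := mB phi.
  split; last by move=> r /= r01; exact: m1.
  by move=> [phi psi] /= [? ? ?]; rewrite mD// subrr.
move=> [H1 [H2 H3]]; have mB phi : 0 <= m phi <= supp phi.
  by have [/= -> ->] := H1 phi I.
split => //; split=> [phi _|phi psi Hphi Hpsi Hs|r r01]; last exact: H3.
  by have /andP[] := mB phi.
by apply/eqP; rewrite -subr_eq0; apply/eqP; exact: (H2 (phi, psi)).
Qed.

Let convexC : convex_set C.
Proof.
move=> m n l /[!inE] -[[m0 mD m1] mB] [[n0 nD n1] nB].
have l0 : 0 <= l%:num by []. have l1 : l%:num <= 1 by [].
have E phi : (conv l m n : (G -> R) -> R) phi =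
    l%:num * m phi + (1 - l%:num) * n phi by [].
split; first split.
- move=> phi Hphi; rewrite E; have := m0 _ Hphi; have := n0 _ Hphi; nra.
- by move=> phi psi ? ? ?; rewrite !E mD// nD//; ring.
- by move=> r r01; rewrite !E m1// n1//; ring.
- move=> phi; rewrite !E; have := mB phi; have := nB phi; nra.
Qed.

(** Co-amenability is applied to the compact convex set [C] of means, on which [G] acts by
    translation: a fixed point is an invariant mean. *)
Lemma coamenable_mean : subgroup L -> coamenable R L ->
  exists2 m, coset_mean m &
    forall g phi, coset_weight phi -> m (fun x => phi (g * x)%g) = m phi.
Proof.
move=> [L1 Ldiv] Lco.
(* The point mass at the trivial coset, extended by 0 to respect the bound [supp]; it is fixed by
   [L]. *)
pose ev1 : ptws_space (G -> R) R :=
  fun phi => if `[< coset_weight phi >] then phi 1%g else 0.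
have Cev1 : C ev1.
  split; first split.
  - by move=> phi Hphi; rewrite /ev1 asboolT//; have /andP[] := Hphi.1 1%g.
  - by move=> phi psi ? ? ?; rewrite /ev1 !asboolT.
  - by move=> r r01; rewrite /ev1 asboolT.
  - move=> phi; rewrite /ev1 /supp; case: asboolP => [[H _]|_]; first exact: H.
    by rewrite lexx.
have aff : affine_action_on C act.
  split=> [g x|||]; first exact: actC.
  - split=> [x _|g h x _]; apply/funext => phi; congr (x _); apply/funext => y.
      by rewrite mul1g.
    by rewrite mulgA.
  - by move=> g; apply: continuous_subspaceT; exact: act_continuous.
  - by [].
have fixL : exists x, C x /\ forall l, L l -> act l x = x.
  exists ev1; split => // l Ll; apply/funext => phi; rewrite /act /ev1.
  have -> : `[< coset_weight (fun x => phi (l * x)%g) >] = `[< coset_weight phi >].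
    by congr asbool; apply/propext; exact: coset_weight_shift.
  by case: asboolP => // -[_ H]; rewrite mulg1 -[X in phi X]mul1g H.
have [m [[Cm _] Hm]] := Lco _ _ _ (@ptws_hausdorff _ _) compactC convexC
  (ex_intro _ _ Cev1) aff fixL.
exists m => // g phi _; exact: (congr1 (fun m : (G -> R) -> R => m phi) (Hm g)).
Qed.

End mean.

(** * Averaging a function on the group *)

Section gmean.
Variables (R : realType) (G : groupType) (mu : G -> R).
Hypothesis hmu : prob_on_group mu.

(** The average of [a] against [mu]. For [a] with values in [0,1] the sum is at most 1, so [fine]
    loses nothing ([gmean_esum]). *)
Definition gmean (a : G -> R) : R := fine (\esum_(h in [set: G]) (mu h * a h)%:E).

Lemma gmean_esum a : (forall h, 0 <= a h <= 1) ->
  \esum_(h in [set: G]) (mu h * a h)%:E = (gmean a)%:E.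
Proof.
move=> a01; rewrite /gmean fineK// ge0_fin_numE; last first.
  by apply: esum_ge0 => h _; rewrite lee_fin mulr_ge0 ?hmu.1//; case/andP: (a01 h).
apply: (@le_lt_trans _ _ 1%E); last by rewrite ltry.
rewrite -hmu.2; apply: le_esum => h _; rewrite lee_fin ler_piMr ?hmu.1//.
by case/andP: (a01 h).
Qed.

Lemma gmean_ge0 a : (forall h, 0 <= a h <= 1) -> 0 <= gmean a.
Proof.
move=> a01; rewrite -lee_fin -gmean_esum//; apply: esum_ge0 => h _.
by rewrite lee_fin mulr_ge0 ?hmu.1//; case/andP: (a01 h).
Qed.

Lemma gmean_le a b : (forall h, 0 <= a h <= 1) -> (forall h, 0 <= b h <= 1) ->
  (forall h, a h <= b h) -> gmean a <= gmean b.
Proof.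
move=> a01 b01 ab; rewrite -lee_fin -!gmean_esum//; apply: le_esum => h _.
by rewrite lee_fin ler_wpM2l ?hmu.1.
Qed.

Lemma gmeanD a b : (forall h, 0 <= a h <= 1) -> (forall h, 0 <= b h <= 1) ->
  gmean (fun h => a h + b h) = gmean a + gmean b.
Proof.
move=> a01 b01; rewrite {1}/gmean.
rewrite (_ : \esum_(h in [set: G]) _ = (gmean a)%:E + (gmean b)%:E)%E//.
rewrite -!gmean_esum// -esumD.
- by apply: eq_esum => h _; rewrite mulrDr EFinD.
- by move=> h _; rewrite lee_fin mulr_ge0 ?hmu.1//; case/andP: (a01 h).
- by move=> h _; rewrite lee_fin mulr_ge0 ?hmu.1//; case/andP: (b01 h).
Qed.

Lemma gmean1 : gmean (fun=> 1) = 1.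
Proof. by rewrite /gmean; under eq_esum do rewrite mulr1; rewrite hmu.2. Qed.

Lemma gmean_onem a : (forall h, 0 <= a h <= 1) ->
  gmean (fun h => 1 - a h) = 1 - gmean a.
Proof.
move=> a01; have c01 h : 0 <= 1 - a h <= 1.
  by have /andP[? ?] := a01 h; apply/andP; split; lra.
have := gmeanD c01 a01; rewrite (_ : (fun h => 1 - a h + a h) = (fun=> 1)).
  by rewrite gmean1 => E; rewrite [X in _ = X - _]E addrK.
by apply/funext => h; rewrite subrK.
Qed.

Lemma sum_le_gmean a (F : seq G) : uniq F -> (forall h, 0 <= a h <= 1) ->
  \sum_(h <- F) mu h * a h <= gmean a.
Proof.
move=> uF a01; rewrite -lee_fin -gmean_esum//; apply: esum_ge.
exists [set` F]; first by split => //; exact: finite_seq.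
by rewrite -fsbig_seq// sumEFin.
Qed.

(** Together with [sum_le_gmean], this reduces averages to finite partial sums, with which finitely
    additive objects are compatible. *)
Lemma gmean_sup a c : (forall h, 0 <= a h <= 1) ->
  (forall F : seq G, uniq F -> \sum_(h <- F) mu h * a h <= c) -> gmean a <= c.
Proof.
move=> a01 H; rewrite -lee_fin -gmean_esum//; apply: ge_ereal_sup => _ [F [finF _] <-].
rewrite fsbig_finite//= sumEFin lee_fin.
by apply: H; exact: finmap.fset_uniq.
Qed.

End gmean.

(** * Limits along an ultrafilter *)

Section ulim.
Variable R : realType.

Definition bounded_seq (a : nat -> R) := exists M, forall n, `|a n| <= M.

Lemma bounded_seq_unit a : (forall n, 0 <= a n <= 1) -> bounded_seq a.
Proof. by move=> a01; exists 1 => n; have /andP[? ?] := a01 n; rewrite ger0_norm. Qed.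

(** [LIM] is the limit along an ultrafilter finer than [\oo]: a bounded sequence stays in a compact
    segment, so it converges along the ultrafilter. *)
Lemma generalized_limit : exists LIM : (nat -> R) -> R,
  [/\ forall a b c, bounded_seq a -> bounded_seq b ->
        LIM (fun n => c * a n + b n) = c * LIM a + LIM b,
      forall a b, bounded_seq a -> bounded_seq b -> (forall n, a n <= b n) ->
        LIM a <= LIM b &
      forall a l, a @ \oo --> l -> LIM a = l].
Proof.
have [U [UU sU]] := ultraFilterLemma (eventually_filter : ProperFilter \oo).
have cv a : bounded_seq a -> cvg (a @ U).
  move=> [M aM]; have := @segment_compact R (- M) M; rewrite compact_ultra.
  have UaU : UltraFilter (a @ U).
    split=> [|V FV sV]; first exact: fmap_proper_filter.
    apply/seteqP; split=> A; last exact: sV.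
    move=> VA; have [//|UnA] := in_ultra_setVsetC (a @^-1` A) UU.
    have /sV VnA : (a @ U) (~` A) by [].
    have : V set0 by rewrite -(setICr A); exact: filterI.
    by move/filter_ex => [].
  move=> /(_ (a @ U) UaU) [].
    apply: (@filterS _ U _ setT) => [n _|]; last exact: filterT.
    by rewrite /= in_itv/= -ler_norml.
  by move=> l [_ al]; apply/cvg_ex; exists l.
exists (fun a => lim (a @ U)); split.
- move=> a b c ba bb; apply/cvg_lim => //.
  by apply: cvgD; [apply: cvgMl_tmp|]; exact: cv.
- by move=> a b ba bb ab; apply: ler_lim; [exact: cv|exact: cv|exact: nearW].
- by move=> a l al; apply/cvg_lim => // A /al/sU.
Qed.

End ulim.

(** * Stationary families of contents *)

Section content_family.
Variables (R : realType) (G : groupType) (mu : G -> R) (phi : G -> R).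
Hypothesis hmu : prob_on_group mu.
Hypothesis phi1 : phi 1%g = 1.
Hypothesis phi01 : forall g, 0 <= phi g <= 1.
Hypothesis phiJ : forall g, gmean mu (fun h => phi (h^-1 * g * h)%g) = phi g.

(* For [phi g = nu (Fix g)], think of [p g S] as the measure of the pairs (x, s)
   with x fixed by g and s in S, for a finitely additive measure with X-marginal
   nu on X x G all of whose fibres over x are invariant under the stabilizer of
   x. *)
Record content_family (p : G -> set G -> R) : Prop := ContentFamily {
  cfam_ge0 : forall g S, 0 <= p g S;
  cfamU : forall g S S', S `&` S' = set0 -> p g (S `|` S') = p g S + p g S';
  cfamT : forall g, p g setT = phi g;
  cfam_le : forall g S, p g S <= p 1%g S;
  cfam_inv : forall g S, p g [set s | S (g * s)%g] = p g S }.

Lemma cfam_unit p : content_family p -> forall g S, 0 <= p g S <= 1.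
Proof.
move=> [p0 pU pT _ _] g S; rewrite p0/=; apply: (@le_trans _ _ (phi g)).
  by rewrite -pT -(setUCr S) pU ?setICr// lerDl.
by case/andP: (phi01 g).
Qed.

Lemma cfam_mono p : content_family p -> forall g S S', S `<=` S' -> p g S <= p g S'.
Proof.
move=> [p0 pU _ _ _] g S S' SS'; rewrite -(setUIDK S' S) (setIidr SS') pU ?lerDl//.
by rewrite setDE setICA setICr setI0.
Qed.

(** Replaces the pair (x, s) by (hx, hs) with h of law [mu]: the point hx is fixed by g exactly when
    x is fixed by h^-1 g h. *)
Definition average_family (p : G -> set G -> R) : G -> set G -> R := fun g S =>
  gmean mu (fun h => p (h^-1 * g * h)%g [set s | S (h * s)%g]).

Lemma average_family_cfam p : content_family p -> content_family (average_family p).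
Proof.
move=> Hp; have p01 := cfam_unit Hp; case: Hp => p0 pU pT ple pinv; split.
- by move=> g S; apply: gmean_ge0.
- move=> g S S' SS'; rewrite /average_family -gmeanD//; congr gmean.
  apply/funext => h; rewrite -pU//; apply/seteqP; split => // s /= -[Ss S's].
  by have : (S `&` S') (h * s)%g by []; rewrite SS'.
- by move=> g; rewrite /average_family -[RHS]phiJ; congr gmean; apply/funext => h; rewrite -pT.
- move=> g S; apply: gmean_le => // h; apply: le_trans (ple _ _) _.
  by rewrite mulg1 mulVg.
(* Since g h = h (h^-1 g h), translating by g after h amounts to translating first by the conjugate,
   for which [pinv] holds. *)
- move=> g S; rewrite /average_family; congr gmean; apply/funext => h.
  rewrite -[RHS]pinv; congr p; apply/seteqP; split=> s /=;
    by rewrite !mulgA mulgV mul1g.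
Qed.

(** A generalized limit of the Cesaro means of the iterates of [average_family]. [LIM] commutes with
    finite sums but not with infinite ones, so only an inequality comes out; it becomes an equality
    for the regularized measure. *)
Lemma stationary_cfam p0 : content_family p0 ->
  exists2 p, content_family p &
    forall S, gmean mu (fun h => p 1%g [set s | S (h * s)%g]) <= p 1%g S.
Proof.
move=> Hp0; have [LIM [LIM_lin LIM_le LIM_cvg]] := generalized_limit R.
pose T k := iter k average_family p0.
have HT k : content_family (T k).
  by elim: k => [//|k IH]; exact: average_family_cfam.
have T01 k := cfam_unit (HT k).
pose A n g S := n.+1%:R^-1 * \sum_(k < n.+1) T k g S.
have A01 n g S : 0 <= A n g S <= 1.
  rewrite /A mulr_ge0 ?invr_ge0//=; last by apply: sumr_ge0 => k _; case/andP: (T01 k g S).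
  rewrite mulrC ler_pdivrMr// mul1r.
  have -> : n.+1%:R = \sum_(k < n.+1) (1 : R) by rewrite sumr_const card_ord.
  by apply: ler_sum => k _; case/andP: (T01 k g S).
have Ab g S : bounded_seq (fun n => A n g S) by apply: bounded_seq_unit.
have LIM_cst c : LIM (fun=> c) = c by apply: LIM_cvg; exact: cvg_cst.
have bcst (c : R) : bounded_seq (fun=> c) by exists `|c|.
have LIMD a b : bounded_seq a -> bounded_seq b -> LIM (fun n => a n + b n) = LIM a + LIM b.
  move=> ba bb; rewrite -[LIM a]mul1r -LIM_lin//; congr LIM.
  by apply/funext => n; rewrite mul1r.
exists (fun g S => LIM (fun n => A n g S)).
  split.
  - by move=> g S; rewrite -(LIM_cst 0); apply: LIM_le => // n; case/andP: (A01 n g S).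
  - move=> g S S' SS'; rewrite -LIMD//; congr LIM; apply/funext => n.
    rewrite /A -mulrDr -big_split/=; congr (_ * _); apply: eq_bigr => k _.
    by have [_ -> //] := HT k.
  - move=> g; rewrite -[RHS]LIM_cst; congr LIM; apply/funext => n; rewrite /A.
    under eq_bigr => k _ do rewrite (cfamT (HT k)).
    by rewrite sumr_const card_ord -[phi g *+ _]mulr_natl mulKf// pnatr_eq0.
  - move=> g S; apply: LIM_le => // n; rewrite /A ler_wpM2l ?invr_ge0//.
    by apply: ler_sum => k _; exact: (cfam_le (HT k)).
  - move=> g S; congr LIM; apply/funext => n; rewrite /A; congr (_ * _).
    by apply: eq_bigr => k _; exact: (cfam_inv (HT k)).
move=> S; apply: gmean_sup => //.
  move=> h; rewrite -{1}(LIM_cst 0) -(LIM_cst 1).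
  by apply/andP; split; apply: LIM_le => // n;
    case/andP: (A01 n 1%g [set s | S (h * s)%g]).
move=> F uF; pose B n := \sum_(h <- F) mu h * A n 1%g [set s | S (h * s)%g].
have [Bb ->] : bounded_seq B /\
    \sum_(h <- F) mu h * LIM (fun n => A n 1%g [set s | S (h * s)%g]) = LIM B.
  rewrite /B; elim: (F) => [|h F' [[M HM] IH]].
    under [X in bounded_seq X]eq_fun do rewrite big_nil.
    under [X in LIM X]eq_fun do rewrite big_nil.
    by rewrite big_nil LIM_cst; split => //; exact: bcst.
  under [X in bounded_seq X]eq_fun do rewrite big_cons.
  under [X in LIM X]eq_fun do rewrite big_cons.
  split; last by rewrite LIM_lin ?big_cons ?IH//; exists M.
  exists (mu h + M) => n; apply: le_trans (ler_normD _ _) (lerD _ (HM n)).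
  have /andP[? ?] := A01 n 1%g [set s | S (h * s)%g].
  rewrite ger0_norm; last by apply: mulr_ge0 => //; exact: hmu.1.
  by apply: ler_piMr => //; exact: hmu.1.
(* The added null sequence leaves the limit unchanged and absorbs the telescoping error: passing
   from [T k] to [T k.+1] raises the Cesaro mean by at most 1/(n+1). *)
have -> : LIM (fun n => A n 1%g S) = LIM (fun n => A n 1%g S + n.+1%:R^-1).
  rewrite LIMD//; last first.
    by exists 1 => n; rewrite ger0_norm ?invr_ge0// invf_le1 ?ler1n.
  by rewrite (LIM_cvg (fun n => n.+1%:R^-1) 0) ?addr0//; exact: (@cvg_harmonic R).
apply: LIM_le => //.
  by exists 2 => n; have /andP[? ?] := A01 n 1%g S;
    rewrite ger0_norm ?addr_ge0 ?invr_ge0// (_ : 2 = 1 + 1)// lerD// invf_le1 ?ler1n.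
move=> n; rewrite /B /A.
have -> : \sum_(h <- F) mu h * (n.+1%:R^-1 * \sum_(k < n.+1) T k 1%g [set s | S (h * s)%g])
  = n.+1%:R^-1 * \sum_(k < n.+1) \sum_(h <- F) mu h * T k 1%g [set s | S (h * s)%g].
  rewrite exchange_big mulr_sumr; apply: eq_bigr => h _.
  by rewrite mulrCA mulr_sumr.
rewrite -[X in _ + X]mulr1 -mulrDr ler_wpM2l ?invr_ge0//.
apply: (@le_trans _ _ (\sum_(k < n.+1) T k.+1 1%g S)).
  apply: ler_sum => k _; rewrite /T iterS -/(T k) /average_family.
  under [X in _ <= gmean mu X]eq_fun do rewrite mulg1 mulVg.
  by apply: sum_le_gmean.
rewrite [in leLHS]big_ord_recr [in leRHS]big_ord_recl/=.
have /andP[_ ?] := T01 n.+1 1%g S; have /andP[? _] := T01 0%N 1%g S.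
have -> : \sum_(i < n) T (bump 0 i) 1%g S = \sum_(i < n) T i.+1 1%g S by [].
rewrite -[average_family _ _ _]/(T n.+1 1%g S) -[p0 1%g S]/(T 0%N 1%g S).
lra.
Qed.

End content_family.

(** * Countable operations and real-valued probabilities *)

Section countable_index.
Variables (I : choiceType) (i0 : I) (cI : countable [set: I]).

(** [e] inverts an injection of [I] into [nat], with default value [i0] off its range. The default
    is harmless: [F i0] is kept only when [P i0] holds. *)
Lemma countable_bigcupE (T : Type) (P : set I) (F : I -> set T) :
  exists e : nat -> I, \bigcup_(i in P) F i =
    \bigcup_n (if `[< P (e n) >] then F (e n) else set0).
Proof.
have /countable_injP[code codeI] := cI.
exists (fun n => xget i0 [set i | code i = n]); apply/seteqP; split=> x.
  move=> [i Pi Fi]; exists (code i) => //.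
  have -> : xget i0 [set j | code j = code i] = i.
    apply: codeI; rewrite ?in_setT//.
    by apply: (xgetPex i0 (P := [set j | code j = code i])); exists i.
  by rewrite asboolT.
move=> [n _]; case: asboolP => // Pn Fx.
by exists (xget i0 [set i | code i = n]).
Qed.

Lemma countable_bigcup_measurable d (T : measurableType d) (P : set I) (F : I -> set T) :
  (forall i, P i -> measurable (F i)) -> measurable (\bigcup_(i in P) F i).
Proof.
move=> mF; have [e ->] := countable_bigcupE P F.
by apply: bigcup_measurable => n _; case: asboolP => // /mF.
Qed.

Lemma countable_bigcap_measurable d (T : measurableType d) (P : set I) (F : I -> set T) :
  (forall i, P i -> measurable (F i)) -> measurable (\bigcap_(i in P) F i).
Proof.
move=> mF; rewrite -[X in measurable X]setCK setC_bigcap; apply: measurableC.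
by apply: countable_bigcup_measurable => i /mF; exact: measurableC.
Qed.

Lemma countable_negligible_bigcup d (T : measurableType d) (R : realType)
    (mu : {measure set T -> \bar R}) (P : set I) (F : I -> set T) :
  (forall i, P i -> mu.-negligible (F i)) -> mu.-negligible (\bigcup_(i in P) F i).
Proof.
move=> nF; have [e ->] := countable_bigcupE P F.
apply: negligible_bigcup => n; case: asboolP => [/nF//|_].
exact: negligible_set0.
Qed.

End countable_index.

Section fine_probability.
Context d (T : measurableType d) (R : realType) (P : probability T R).

Definition fprob (A : set T) : R := fine (P A).

Lemma fprobE A : measurable A -> (fprob A)%:E = P A.
Proof. by move=> mA; rewrite fineK// fin_num_measure. Qed.

Lemma fprob_unit A : measurable A -> 0 <= fprob A <= 1.
Proof.
by move=> mA; rewrite -!lee_fin fprobE// measure_ge0 probability_le1.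
Qed.

Lemma fprobU A B : measurable A -> measurable B -> A `&` B = set0 ->
  fprob (A `|` B) = fprob A + fprob B.
Proof.
move=> mA mB AB; apply: EFin_inj; rewrite EFinD !fprobE//; last exact: measurableU.
exact: measureU.
Qed.

Lemma fprobT : fprob setT = 1.
Proof. by rewrite /fprob probability_setT. Qed.

Lemma fprobC A : measurable A -> fprob (~` A) = 1 - fprob A.
Proof.
move=> mA; apply/eqP; rewrite eq_sym subr_eq -fprobU ?setvU ?fprobT ?setICl//.
exact: measurableC.
Qed.

Lemma fprob_le A B : measurable A -> measurable B -> A `<=` B -> fprob A <= fprob B.
Proof. by move=> mA mB AB; rewrite -lee_fin !fprobE// le_measure ?inE. Qed.

Lemma fprob0 A : measurable A -> P.-negligible A -> fprob A = 0.
Proof. by move=> mA nA; rewrite /fprob measure_negligible. Qed.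

Lemma fprob_setI_conull A B : measurable A -> measurable B -> P.-negligible (~` B) ->
  fprob (A `&` B) = fprob A.
Proof.
move=> mA mB nB.
have mAB : measurable (A `&` B) by exact: measurableI.
have mAD : measurable (A `&` ~` B) by apply: measurableI => //; exact: measurableC.
rewrite -[A in RHS]setIT -(setUCr B) setIUr fprobU//; last first.
  by rewrite setIACA setIid setICr setI0.
rewrite (fprob0 mAD) ?addr0//; apply: negligibleS nB => x []//.
Qed.

End fine_probability.

(** * A content family from stabilizers acting freely on cosets *)

Section initial_family.
Variables (R : realType) (G : groupType) (cG : countable [set: G]).
Variables (L : set G) (hL : subgroup L) (m : (G -> R) -> R).
Hypothesis hm : coset_mean L m.
Hypothesis m_inv : forall g phi, coset_weight L phi ->
  m (fun x => phi (g * x)%g) = m phi.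
Context d (X : measurableType d) (a : G -> X -> X) (nu : probability X R).
Hypothesis hX : measurable_action a nu.
Hypothesis hfix : measurable_fixpoints a.
Hypothesis hfree : essentially_free L a nu.

Let Fix g : set X := [set x | a g x = x].
Let L1 : L 1%g. Proof. by have [/set_mem] := hL. Qed.
Let Lv x y : L x -> L y -> L (x * y^-1)%g.
Proof. by have [_ H] := hL; move=> Lx Ly; apply/set_mem/H; exact/mem_set. Qed.
Let LV x : L x -> L x^-1%g.
Proof. by move=> Lx; rewrite -[(_^-1)%g]mul1g; exact: Lv. Qed.
Let LM x y : L x -> L y -> L (x * y)%g.
Proof. by move=> Lx Ly; rewrite -[y]invgK; apply: Lv => //; exact: LV. Qed.

Let a1 x : a 1%g x = x. Proof. by have [[-> _] _ _] := hX. Qed.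
Let aM g h x : a (g * h)%g x = a g (a h x). Proof. by have [[_ ->] _ _] := hX. Qed.

Let FixV g x : Fix g x -> Fix g^-1%g x.
Proof. by rewrite /Fix/= => {1}<-; rewrite -aM mulVg a1. Qed.
Let FixM g h x : Fix g x -> Fix h x -> Fix (g * h)%g x.
Proof. by rewrite /Fix/= aM => gx ->. Qed.

(** An injective numbering of the left cosets: the code of a representative chosen from cL as a set,
    hence the same for all elements of the coset. *)
Let rho_ex : exists rho : G -> nat, (forall c l, L l -> rho (c * l)%g = rho c) /\
  forall c c', rho c = rho c' -> L (c^-1 * c')%g.
Proof.
have /countable_injP[code codeI] := cG.
pose coset (c : G) : set G := [set (c * l)%g | l in L].
exists (fun c => code (xget 1%g (coset c))); split=> [c l Ll|c c'].
  congr (code (xget _ _)); apply/seteqP; split=> x [k Lk <-].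
    by exists (l * k)%g; rewrite ?mulgA//; exact: LM.
  by exists (l^-1 * k)%g; rewrite ?mulgA ?mulgK//; apply: LM => //; exact: LV.
have H b : coset b (xget 1%g (coset b)).
  by apply: xgetPex; exists b; exists 1%g; rewrite ?mulg1.
move/codeI; rewrite !in_setT => /(_ isT isT) E.
have [l Ll lE] := H c; have [l' Ll' lE'] := H c'.
have -> : (c^-1 * c' = l * l'^-1)%g.
  rewrite -[c'](mulgK l') lE' -E -lE !mulgA mulVg mul1g.
  by [].
exact: Lv.
Qed.

(** The nontrivial elements conjugate into [L]. Thus [X0] consists of the points whose stabilizer
    meets every conjugate of [L] trivially. *)
Let D : set G := [set h | h <> 1%g /\ exists c, L (c^-1 * h * c)%g].
Let X0 : set X := ~` \bigcup_(h in D) Fix h.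

Let mX0 : measurable X0.
Proof.
by apply: measurableC; apply: (countable_bigcup_measurable 1%g) => // h _; exact: hfix.
Qed.

(** Fix h is the translate by c of Fix (c^-1 h c), which is null by freeness of [L]; non-singularity
    keeps the translate null, and there are countably many h. *)
Let nX0 : nu.-negligible (~` X0).
Proof.
rewrite setCK; apply: (countable_negligible_bigcup 1%g) => // h [h1 [c Lc]].
have nFc : nu.-negligible (Fix (c^-1 * h * c)%g).
  apply: hfree => // E; apply: h1.
  have : (c * (c^-1 * h * c) * c^-1 = 1)%g by rewrite E mulg1 mulgV.
  by rewrite !mulgA mulgV mul1g -mulgA mulgV mulg1.
have [_ _ ns] := hX.
apply/negligibleP; first exact: hfix.
apply/(ns c _ (hfix h)); rewrite /pushforward.
rewrite (_ : _ @^-1` _ = Fix (c^-1 * h * c)%g); first by apply: measure_negligible => //; exact: hfix.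
apply/seteqP; split=> x; rewrite /Fix/= !aM; first by move=> ->; rewrite -aM mulVg a1.
by move=> E; rewrite -[in RHS]E -[RHS]aM mulgV a1.
Qed.

Let rho := sval (cid rho_ex).
Let rhoL c l : L l -> rho (c * l)%g = rho c.
Proof. by rewrite /rho; case: cid => r [/= + _]; apply. Qed.
Let rho_inj c c' : rho c = rho c' -> L (c^-1 * c')%g.
Proof. by rewrite /rho; case: cid => r [/= _]; apply. Qed.

(* For x in X0 the stabilizer of x acts freely on the cosets, and [minfix c h x]
   says that h is the element of the stabilizer moving to the coset [c L] the
   representative (of least number) of the orbit of [c L]; thus [c |-> h] is
   equivariant under the stabilizer. *)
Let minfix c h : set X :=
  [set x | Fix h x /\ forall h', Fix h' x -> (rho (h^-1 * c) <= rho (h'^-1 * c))%N].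

Let minfix_ex c x : exists h, minfix c h x.
Proof.
have ex : exists n, `[< exists2 h, Fix h x & rho (h^-1 * c) = n >].
  by exists (rho (1^-1 * c)%g); apply/asboolP; exists 1%g => //; exact: a1.
case: (ex_minnP ex) => n /asboolP[h Fh hn] nmin; exists h; split=> // h' Fh'.
by rewrite hn; apply: nmin; apply/asboolP; exists h'.
Qed.

(** Two minimizers reach cosets with the same number, hence the same coset; then h'^-1 h lies in the
    stabilizer and in a conjugate of [L], so it is trivial on [X0]. *)
Let minfix_uniq c h h' x : X0 x -> minfix c h x -> minfix c h' x -> h = h'.
Proof.
move=> X0x [Fh Hh] [Fh' Hh']; apply: contrapT => hh'; apply: X0x.
exists (h'^-1 * h)%g; last by apply: FixM => //; exact: FixV.
split; first by move=> E; apply: hh'; rewrite -[LHS](mulVKg h') E mulg1.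
exists (h^-1 * c)%g.
suff -> : ((h^-1 * c)^-1 * (h'^-1 * h) * (h^-1 * c) = (h^-1 * c)^-1 * (h'^-1 * c))%g.
  by apply: rho_inj; apply/eqP; rewrite eqn_leq Hh ?Hh'.
by rewrite !mulgA mulgK.
Qed.

Let minfix_measurable c h : measurable (minfix c h).
Proof.
rewrite (_ : minfix c h = Fix h `&` \bigcap_(h' in
    [set h' | ~ (rho (h^-1 * c) <= rho (h'^-1 * c))%N]) ~` Fix h').
  apply: measurableI; first exact: hfix.
  by apply: (countable_bigcap_measurable 1%g) => // h' _; apply: measurableC; exact: hfix.
apply/seteqP; split=> x [Fh H]; split => //.
  by move=> h' /= nle /H.
by move=> h' Fh'; apply: contrapT => nle; exact: (H h').
Qed.

(** Because (g h)^-1 (g c) = h^-1 c and left translation by g permutes the stabilizer, both sides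
    minimize the same quantity. *)
Let minfix_shift c g h x : Fix g x -> minfix c h x <-> minfix (g * c)%g (g * h)%g x.
Proof.
have K (u v w : G) : ((u * v)^-1 * (u * w) = v^-1 * w)%g.
  by rewrite invgM -mulgA mulKg.
move=> Fg; split=> -[Fh H]; split.
- exact: FixM.
- move=> h' Fh'; rewrite K; have /H := FixM (FixV Fg) Fh'.
  by rewrite -[X in (_ <= rho X)%N -> _](K g) mulVKg.
- by rewrite -[h](mulKg g); apply: FixM => //; exact: FixV.
- by move=> h' Fh'; have /H := FixM Fg Fh'; rewrite !K.
Qed.

Let piece c (S : set G) : set X := \bigcup_(h in S) minfix c h.

Let piece_measurable c S : measurable (piece c S).
Proof. by apply: (countable_bigcup_measurable 1%g). Qed.

Let weight g S c := fprob nu (Fix g `&` (X0 `&` piece c S)).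

Let mFX g c S : measurable (Fix g `&` (X0 `&` piece c S)).
Proof. by apply: measurableI; [exact: hfix|exact: measurableI]. Qed.

Let weight_coset g S : coset_weight L (weight g S).
Proof.
split=> [c|c l Ll]; first exact: fprob_unit.
have E h : rho (h^-1 * (c * l))%g = rho (h^-1 * c)%g.
  by rewrite mulgA; exact: rhoL.
congr (fprob _ (_ `&` (_ `&` _))); apply/seteqP; split=> x [h Sh [Fh H]];
  exists h => //; split=> // h' /H; by rewrite !E.
Qed.

(** [p g S] averages, over cosets cL, the mass of the x fixed by g whose map from G/L to G sends cL
    into S. Existence and uniqueness of minimizers on the conull set [X0] give total mass and
    additivity; [minfix_shift] and invariance of [m] give invariance under g. *)
Lemma initial_cfam :
  exists p, content_family (fun g => fprob nu [set x | a g x = x]) p.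
Proof.
exists (fun g S => m (weight g S)); split.
- by move=> g S; exact: (coset_mean_ge0 hm).
- move=> g S S' SS'.
  have wD : weight g (S `|` S') = weight g S \+ weight g S'.
    apply/funext => c; rewrite /= /weight -fprobU//.
      by rewrite /piece bigcup_setU !setIUr.
    rewrite -subset0 => x [[_ [X0x [h Sh Hh]]] [_ [_ [h' Sh' Hh']]]].
    have : (S `&` S') h' by split=> //; rewrite -(minfix_uniq X0x Hh Hh').
    by rewrite SS'.
  by rewrite wD (coset_meanD hm)// -wD.
- move=> g; rewrite (_ : weight g setT = fun=> fprob nu (Fix g)).
    by rewrite (coset_mean_cst hm)// fprob_unit//; exact: hfix.
  apply/funext => c; rewrite /weight (_ : piece c setT = setT).
    by rewrite setIT fprob_setI_conull//; exact: hfix.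
  by apply/seteqP; split => // x _; have [h hx] := minfix_ex c x; exists h.
- move=> g S; apply: (coset_mean_le hm) => // c; apply: fprob_le => // x [_ ?].
  by split => //; exact: a1.
- move=> g S; rewrite -[RHS](m_inv g)//; congr m; apply/funext => c.
  congr fprob; apply/seteqP; split=> x [Fg [X0x [h Sh Hh]]]; split => //; split => //.
    by exists (g * h)%g => //; apply/(minfix_shift c h Fg).
  exists (g^-1 * h)%g; first by rewrite /= mulVKg.
  by apply/(minfix_shift c _ Fg); rewrite mulVKg.
Qed.

End initial_family.

(** * Borel sets and fixed points of actions by homeomorphisms *)

Section borel_action.
Variables (R : realType) (G : groupType) (K : ptopologicalType) (b : G -> K -> K).
Hypothesis hb : compact_space_action b.

Lemma borel_open_measurable (U : set K) : open U -> measurable (U : set (borel K)).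
Proof. by move=> oU; exact: sub_sigma_algebra. Qed.

Lemma borel_closed_measurable (C : set K) : closed C -> measurable (C : set (borel K)).
Proof.
move=> cC; rewrite -[C]setCK; apply: measurableC; apply: borel_open_measurable.
exact: closed_openC.
Qed.

Lemma borel_action_preimage g (A : set (borel K)) :
  measurable A -> measurable (b g @^-1` A : set (borel K)).
Proof.
move=> mA; rewrite -[X in measurable X]setTI.
apply: (@measurability _ _ (borel K) (borel K) setT (b g) open) => //.
move=> _ [U oU <-]; rewrite setTI; apply: borel_open_measurable.
by have [_ _ _ /(_ g)/continuousP] := hb; exact.
Qed.

Lemma fixpoints_closed g : closed [set x | b g x = x].
Proof.
have [_ bh _ /(_ g) bc] := hb; rewrite -[X in closed X]setCK; apply: open_closedC.
rewrite openE => x /= /eqP bx.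
move: bh; rewrite open_hausdorff => /(_ _ _ bx)[[U V] /=] [/set_mem Ux /set_mem Vx [oU oV UV]].
apply: (filterS (P := (b g @^-1` U) `&` V)).
  move=> y [/= Uy Vy] E; have : (U `&` V) y by split => //; rewrite -E.
  by rewrite (eqP UV).
apply: filterI; last exact: open_nbhs_nbhs.
by apply: bc; exact: open_nbhs_nbhs.
Qed.

End borel_action.

(** * Regularization of a finitely additive content on a compact space *)

Section regularization.
Variables (R : realType) (K : ptopologicalType).
Hypothesis Kc : compact [set: K].
Hypothesis Kh : hausdorff_space K.
Variable theta : set K -> R.
Hypothesis theta0 : forall A, 0 <= theta A.
Hypothesis thetaU : forall A B, A `&` B = set0 -> theta (A `|` B) = theta A + theta B.
Hypothesis thetaT : theta setT = 1.

Let theta_mono A B : A `<=` B -> theta A <= theta B.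
Proof.
move=> AB; rewrite -(setUIDK B A) (setIidr AB) thetaU ?lerDl//.
by rewrite setDE setICA setICr setI0.
Qed.

Let theta_le1 A : theta A <= 1.
Proof. by rewrite -thetaT; apply: theta_mono. Qed.

Let theta_subU A B : theta (A `|` B) <= theta A + theta B.
Proof.
have -> : A `|` B = A `|` (B `\` A).
  apply/seteqP; split=> x [Ax|]; [by left| |by left|by case; right].
  by move=> Bx; have [Ax|nAx] := pselect (A x); [left|right].
rewrite thetaU; first by rewrite lerD2l; apply: theta_mono => x [].
by rewrite -subset0 => x [Ax [_]].
Qed.

Let theta_set0 : theta set0 = 0.
Proof. by have := thetaU (setI0 set0); rewrite setU0; lra. Qed.

(** Approximation of the finitely additive [theta] from inside by closed sets. On open sets it is
    countably subadditive, by compactness, and generates the outer measure [outer]. *)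
Definition inner (U : set K) : R :=
  sup [set theta C | C in [set C | closed C /\ C `<=` U]].

Let inner_has_sup U : has_sup [set theta C | C in [set C | closed C /\ C `<=` U]].
Proof.
split; first by exists (theta set0), set0 => //; split; [exact: closed0|exact: sub0set].
by exists 1 => _ [C _ <-].
Qed.

Lemma theta_inner C U : closed C -> C `<=` U -> theta C <= inner U.
Proof. by move=> cC CU; apply: (sup_upper_bound (inner_has_sup U)); exists C. Qed.

Lemma inner_adherent U e : 0 < e ->
  exists C, [/\ closed C, C `<=` U & inner U - e < theta C].
Proof.
by move=> /sup_adherent/(_ (inner_has_sup U))[_ [C [cC CU] <-] H]; exists C.
Qed.

Let inner_le U c : (forall C, closed C -> C `<=` U -> theta C <= c) -> inner U <= c.
Proof. by move=> H; apply: ge_sup => [|_ [C [cC CU] <-]]; [case: (inner_has_sup U)|exact: H]. Qed.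

Let inner_mono U V : U `<=` V -> inner U <= inner V.
Proof. by move=> UV; apply: inner_le => C cC CU; apply: theta_inner => // x /CU/UV. Qed.

Let inner_ge0 U : 0 <= inner U.
Proof. by rewrite -theta_set0; apply: theta_inner; [exact: closed0|exact: sub0set]. Qed.

Let inner_le1 U : inner U <= 1.
Proof. exact: inner_le. Qed.

Let innerT : inner setT = 1.
Proof.
by apply/eqP; rewrite eq_le inner_le1 -{1}thetaT theta_inner//; exact: closedT.
Qed.

Let inner0 : inner set0 = 0.
Proof.
apply/eqP; rewrite eq_le inner_ge0 andbT; apply: inner_le => C _.
by rewrite subset0 => ->; rewrite theta_set0.
Qed.

Let innerU U V : open U -> open V -> inner (U `|` V) <= inner U + inner V.
Proof.
move=> oU oV; apply: inner_le => C cC CUV.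
have cCV : closed (C `\` V) by rewrite setDE; apply: closedI => //; exact: open_closedC.
(* Normality cuts [C] into two closed pieces: the part in the closure of [W] lies in [U], and the
   part off [Q] lies in [V]. *)
have [|W /set_nbhsP[Q [oQ CQ QW]] WU] := compact_normal Kh Kc cCV (t := U).
  by apply/set_nbhsP; exists U; split => // x [Cx nVx]; have [] := CUV x Cx.
have -> : C = (C `&` closure W) `|` (C `\` Q).
  apply/seteqP; split=> [x Cx|x]; last by move=> [[]|[]].
  by have [/QW/subset_closure ?|] := pselect (Q x); [left|right].
apply: le_trans (theta_subU _ _) (lerD _ _).
  by apply: theta_inner => [|x [_ /WU]//]; apply: closedI => //; exact: closed_closure.
apply: theta_inner.
  by rewrite setDE; apply: closedI => //; exact: open_closedC.
by move=> x [Cx nQx]; apply: contrapT => nVx; apply: nQx; exact: CQ.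
Qed.

Let inner_bigU (U : nat -> set K) n : (forall i, open (U i)) ->
  inner (\bigcup_(i < n) U i) <= \sum_(i < n) inner (U i).
Proof.
move=> oU; elim: n => [|n IH].
  by rewrite big_ord0 bigcup_mkord big_ord0 inner0.
rewrite big_ord_recr/= (_ : \bigcup_(i < n.+1) U i = \bigcup_(i < n) U i `|` U n).
  apply: le_trans (innerU _ _) _ => //; first by apply: bigcup_open => i _.
  by rewrite lerD2r.
by rewrite !bigcup_mkord big_ord_recr.
Qed.

(** A nearly optimal closed subset of the union is compact, so finitely many of the [U i] cover it
    and finite subadditivity suffices. *)
Let inner_sigma (U : nat -> set K) : (forall i, open (U i)) ->
  ((inner (\bigcup_i U i))%:E <= \sum_(0 <= i <oo) (inner (U i))%:E)%E.
Proof.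
move=> oU; apply/lee_addgt0Pr => e e0.
have [C [cC CU CE]] := inner_adherent (\bigcup_i U i) e0.
have Cc : compact C by exact: subclosed_compact Kc _.
move: Cc; rewrite compact_cover => /(_ nat setT U (fun i _ => oU i) CU)[D _ CD].
pose n := (\max_(i <- finmap.enum_fset D) i).+1.
have Cn : C `<=` \bigcup_(i < n) U i.
  move=> x /CD[i iD Ux]; exists i => //=.
  by rewrite /n ltnS; apply: leq_bigmax_seq.
apply: (@le_trans _ _ ((\sum_(i < n) inner (U i))%:E + e%:E)%E).
  rewrite -EFinD lee_fin; have := inner_bigU n oU; have := theta_inner cC Cn.
  by move: CE; lra.
rewrite leeD2r// -sumEFin -(big_mkord xpredT (fun i => (inner (U i))%:E)).
by apply: nneseries_lim_ge => i _ _; rewrite lee_fin.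
Qed.

Definition outer (A : set K) : R :=
  inf [set inner U | U in [set U | open U /\ A `<=` U]].

Let outer_has_inf A : has_inf [set inner U | U in [set U | open U /\ A `<=` U]].
Proof.
split; first by exists (inner setT), setT => //; split => //; exact: openT.
by exists 0 => _ [U _ <-].
Qed.

Let outer_adherent A e : 0 < e ->
  exists U, [/\ open U, A `<=` U & inner U < outer A + e].
Proof.
by move=> /inf_adherent/(_ (outer_has_inf A))[_ [U [oU AU] <-] H]; exists U.
Qed.

Let outer_le_inner A U : open U -> A `<=` U -> outer A <= inner U.
Proof. by move=> oU AU; apply: (ge_inf (outer_has_inf A).2); exists U. Qed.

Let outer_lb A c : (forall U, open U -> A `<=` U -> c <= inner U) -> c <= outer A.
Proof.
by move=> H; apply: lb_le_inf => [|_ [U [oU AU] <-]]; [case: (outer_has_inf A)|exact: H].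
Qed.

Let outer_open U : open U -> outer U = inner U.
Proof.
move=> oU; apply/eqP; rewrite eq_le outer_le_inner//=.
by apply: outer_lb => V _; exact: inner_mono.
Qed.

Let outer_ge0 A : 0 <= outer A.
Proof. exact: outer_lb. Qed.

Let outer_mono A B : A `<=` B -> outer A <= outer B.
Proof.
by move=> AB; apply: outer_lb => U oU BU; apply: outer_le_inner => // x /AB/BU.
Qed.

Let outerE (A : set K) : \bar R := (outer A)%:E.

Let outerE_sigma : sigma_subadditive outerE.
Proof.
move=> F; apply/lee_addgt0Pr => e e0; rewrite /outerE.
have e2 i : 0 < e / (2 ^ i.+1)%:R by rewrite divr_gt0// ltr0n expn_gt0.
have /choice[U HU] i := outer_adherent (F i) (e2 i).
have oU i : open (U i) by have [] := HU i.
apply: (@le_trans _ _ (inner (\bigcup_i U i))%:E).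
  rewrite lee_fin; apply: outer_le_inner; first exact: bigcup_open.
  by apply: subset_bigcup => i _; have [] := HU i.
apply: le_trans (inner_sigma oU) _.
apply: le_trans (epsilon_trick xpredT _ (ltW e0)); last by move=> n; rewrite lee_fin.
apply: lee_nneseries => i *; rewrite -?EFinD lee_fin//.
by apply: ltW; have [] := HU i.
Qed.

Let outerE0 : outerE set0 = 0%E.
Proof. by rewrite /outerE outer_open ?inner0//; exact: open0. Qed.

Let outerE_ge0 A : (0 <= outerE A)%E.
Proof. by rewrite lee_fin. Qed.

Let outerE_mono : {homo outerE : A B / A `<=` B >-> (A <= B)%E}.
Proof. by move=> A B AB; rewrite lee_fin; exact: outer_mono. Qed.

Let outer_m : {outer_measure set K -> \bar R} :=
  HB.pack_for {outer_measure set K -> \bar R} outerE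
    (isOuterMeasure.Build R K outerE outerE0 outerE_ge0 outerE_mono outerE_sigma).

(** Inside an open [T], take a nearly optimal closed [C] in T ∩ V, then a nearly optimal closed [B]
    in T \ C, which contains T \ V. As [C] and [B] are disjoint, [theta] adds up on them. *)
Let cara_open V : open V -> outer_m.-caratheodory V.
Proof.
move=> oV; apply: le_caratheodory_measurable => X.
change ((outer (X `&` V))%:E + (outer (X `&` ~` V))%:E <= (outer X)%:E)%E.
rewrite -EFinD lee_fin; apply: outer_lb => T oT XT.
have oTV : open (T `&` V) by exact: openI.
apply: (@le_trans _ _ (inner (T `&` V) + outer (T `&` ~` V))).
  rewrite lerD//; first by apply: outer_le_inner => // x [/XT].
  by apply: outer_mono => x [/XT].
rewrite -subr_ge0 -oppr_le0; apply/ler_addgt0Pr => e e0; rewrite add0r.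
have e20 : 0 < e / 2 by rewrite divr_gt0.
have [C [cC CTV CE]] := inner_adherent (T `&` V) e20.
have oTC : open (T `\` C) by rewrite setDE; apply: openI => //; exact: closed_openC.
have [B [cB BTC BE]] := inner_adherent (T `\` C) e20.
have : outer (T `&` ~` V) <= inner (T `\` C).
  by apply: outer_le_inner => // x [Tx nVx]; split => // /CTV[].
have : theta C + theta B <= inner T.
  rewrite -thetaU; last by rewrite -subset0 => x [Cx /BTC[_]].
  apply: theta_inner; first exact: closedU.
  by move=> x [/CTV[]//|/BTC[]].
by move: CE BE; lra.
Qed.

Let cara_borel (A : set (borel K)) : measurable A -> outer_m.-caratheodory A.
Proof.
apply: smallest_sub; last by move=> U oU; exact: cara_open.
exact: (@sigma_algebra_measurable _ (caratheodory_type outer_m)).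
Qed.

(** The measure is [outer] restricted to Borel sets, by Caratheodory. Outer regularity is built in,
    and inner regularity by compact sets follows by passing to complements. *)
Lemma regularization : exists lambda : probability (borel K) R,
  regular_borel lambda /\ forall U : set K, open U -> lambda U = (inner U)%:E.
Proof.
pose l : set (borel K) -> \bar R := outerE.
have l0 : l set0 = 0%E by rewrite /l /outerE outer_open ?inner0//; exact: open0.
have lge0 A : (0 <= l A)%E by rewrite lee_fin.
have lsigma : semi_sigma_additive l.
  move=> F mF tF mUF; apply: (@caratheodory_measure_sigma_additive _ _ outer_m) => //.
    by move=> i; exact: cara_borel.
  exact: cara_borel.
have lT : l setT = 1%E by rewrite /l /outerE outer_open ?innerT//; exact: openT.
pose lm : {measure set (borel K) -> \bar R} :=
  HB.pack_for {measure set (borel K) -> \bar R} l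
  (isMeasure.Build _ (borel K) R l l0 lge0 lsigma).
pose lambda : probability (borel K) R := HB.pack_for (probability (borel K) R)
  (Measure.sort lm) (Measure_isProbability.Build _ (borel K) R lm lT).
exists lambda; split; last by move=> U oU; rewrite -[lambda U]/(l U) /l /outerE outer_open.
have outer_reg (A : set (borel K)) e : measurable A -> 0 < e ->
    exists U : set K, [/\ open U, A `<=` U & (lambda U <= lambda A + e%:E)%E].
  move=> mA e0; have [U [oU AU UE]] := outer_adherent A e0.
  exists U; split => //.
  rewrite -[lambda U]/(outer U)%:E -[lambda A]/(outer A)%:E -EFinD lee_fin.
  by rewrite (outer_open oU) ltW.
move=> A mA; split; apply/eqP; rewrite eq_le; apply/andP; split.
- apply/lee_addgt0Pr => e e0.
  have [U [oU AU UE]] := outer_reg _ _ (measurableC mA) e0.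
  have CA : ~` U `<=` A by rewrite -[A]setCK; apply: subsetC.
  apply: (@le_trans _ _ (lambda (~` U) + e%:E)%E); last first.
    rewrite leeD2r//; apply: ereal_sup_ubound; exists (~` U) => //; split => //.
    by apply: (subclosed_compact _ Kc) => //; exact: open_closedC.
  have mU := borel_open_measurable oU.
  have mUC := measurableC mU. have mAC := measurableC mA.
  move: UE; rewrite (probability_setC _ mA) (probability_setC _ mU).
  rewrite -(fineK (fin_num_measure lambda _ mU)) -(fineK (fin_num_measure lambda _ mA)).
  by rewrite -!EFinB -!EFinD !lee_fin; lra.
- apply: ge_ereal_sup => _ [C [cC CA] <-]; apply: le_measure; rewrite ?inE//.
  by apply: borel_closed_measurable; exact: compact_closed.
- apply: le_ereal_inf_tmp => _ [U [oU AU] <-]; apply: le_measure; rewrite ?inE//.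
  exact: borel_open_measurable.
- apply/lee_addgt0Pr => e e0; have [U [oU AU UE]] := outer_reg _ _ mA e0.
  by apply: le_trans UE; apply: ereal_inf_lbound; exists U.
Qed.

End regularization.

(** * Unique stationarity *)

Section unique_stationary.
Variables (R : realType) (G : groupType) (mu : G -> R) (phi : G -> R).
Hypothesis hmu : prob_on_group mu.
Hypothesis phi1 : phi 1%g = 1.
Hypothesis phi01 : forall g, 0 <= phi g <= 1.
Variable p : G -> set G -> R.
Hypothesis hp : content_family phi p.
Hypothesis pst : forall S, gmean mu (fun h => p 1%g [set s | S (h * s)%g]) <= p 1%g S.
Variables (K : ptopologicalType) (b : G -> K -> K).
Hypothesis hb : compact_space_action b.
Variable nuK : probability (borel K) R.
Hypothesis hK : uniquely_stationary mu b nuK.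

Let Kc : compact [set: K]. Proof. by have [] := hb. Qed.
Let Kh : hausdorff_space K. Proof. by have [] := hb. Qed.
Let b1 x : b 1%g x = x. Proof. by have [_ _ [-> _] _] := hb. Qed.
Let bM g h x : b (g * h)%g x = b g (b h x). Proof. by have [_ _ [_ ->] _] := hb. Qed.
Let bVK g x : b g^-1%g (b g x) = x. Proof. by rewrite -bM mulVg b1. Qed.
Let bKV g x : b g (b g^-1%g x) = x. Proof. by rewrite -bM mulgV b1. Qed.

Let b_open g (U : set K) : open U -> open (b g @^-1` U).
Proof. by have [_ _ _ /(_ g)/continuousP] := hb; exact. Qed.
Let b_closed g (C : set K) : closed C -> closed (b g @^-1` C).
Proof. by have [_ _ _ /(_ g)/continuous_closedP] := hb; exact. Qed.

Let b_mpre g (A : set (borel K)) : measurable A -> measurable (b g @^-1` A : set (borel K)).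
Proof. exact: (borel_action_preimage hb). Qed.

(** The K-marginal of the joining: [p 1] pushed forward along the orbit map of the base point
    [point]. *)
Let theta (A : set K) : R := p 1%g [set s | A (b s point)].

Let theta_ge0 A : 0 <= theta A.
Proof. exact: (cfam_ge0 hp). Qed.

Let thetaU A B : A `&` B = set0 -> theta (A `|` B) = theta A + theta B.
Proof.
move=> AB; rewrite /theta -(cfamU hp)//; apply/seteqP; split=> // s /= sAB.
have : (A `&` B) (b s point) by [].
by rewrite AB.
Qed.

Let thetaT : theta setT = 1.
Proof. by rewrite /theta (cfamT hp). Qed.

Let theta01 A : 0 <= theta A <= 1.
Proof. exact: (cfam_unit phi01 hp). Qed.

Let theta_mono A B : A `<=` B -> theta A <= theta B.
Proof. by move=> AB; apply: (cfam_mono hp) => s /AB. Qed.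

Let theta_st A : gmean mu (fun h => theta (b h @^-1` A)) <= theta A.
Proof.
apply: le_trans (pst [set s | A (b s point)]); rewrite le_eqVlt; apply/orP; left.
apply/eqP; congr gmean; apply/funext => h; congr p; apply/seteqP.
by split=> s /=; rewrite bM.
Qed.

Let inner01 U : 0 <= inner theta U <= 1.
Proof.
have [C [cC _ CE]] := inner_adherent theta_ge0 thetaU thetaT U ltr01.
apply/andP; split.
  apply: (@le_trans _ _ (theta set0)) => //.
  by apply: (theta_inner theta_ge0 thetaU thetaT); [exact: closed0|exact: sub0set].
apply/ler_addgt0Pr => e e0.
have [B [_ _ BE]] := inner_adherent theta_ge0 thetaU thetaT U e0.
by have /andP[_ ?] := theta01 B; move: BE; lra.
Qed.

Let inner_st U : open U ->
  gmean mu (fun h => inner theta (b h @^-1` U)) <= inner theta U.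
Proof.
move=> oU; apply: gmean_sup => // F uF; apply/ler_addgt0Pr => e e0.
have /choice[C HC] h := inner_adherent theta_ge0 thetaU thetaT (b h @^-1` U) e0.
(* The union of the translates by h of the nearly optimal closed sets [C h]: it is closed because
   [F] is finite, and it lies in [U]. *)
pose D := \bigcup_(h in [set` F]) b h^-1%g @^-1` C h.
have cD : closed D.
  apply: closed_bigcup; first exact: finite_seq.
  by move=> h _; apply: b_closed; have [] := HC h.
have DU : D `<=` U.
  move=> x [h _ Cx]; have [_ CU _] := HC h.
  by have := CU _ Cx; rewrite /= bKV.
have -> : \sum_(h <- F) mu h * inner theta (b h @^-1` U) =
    \sum_(h <- F) mu h * (inner theta (b h @^-1` U) - e) + \sum_(h <- F) mu h * e.
  by rewrite -big_split/=; apply: eq_bigr => h _; ring.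
apply: lerD; last first.
  rewrite -mulr_suml ler_piMl ?(ltW e0)//.
  have -> : \sum_(h <- F) mu h = \sum_(h <- F) mu h * 1.
    by apply: eq_bigr => h _; rewrite mulr1.
  by rewrite -[leRHS](gmean1 hmu); apply: sum_le_gmean => // h; rewrite ler01 lexx.
apply: le_trans (theta_inner theta_ge0 thetaU thetaT cD DU).
apply: le_trans (theta_st D); apply: (@le_trans _ _ (\sum_(h <- F) mu h * theta (b h @^-1` D))).
  rewrite big_seq [leRHS]big_seq; apply: ler_sum => h hF; rewrite ler_wpM2l ?hmu.1//.
  have [_ _ /ltW CE] := HC h; apply: le_trans CE _; apply: theta_mono => x Cx.
  by exists h => //=; rewrite bVK.
exact: sum_le_gmean.
Qed.

(** The regularized marginal is stationary, hence equal to [nuK]. The mass of [p g] is then split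
    according to a set close to [B]: its part outside is bounded directly, its part inside after
    translation by g, which preserves [p g]. *)
Lemma fixpoint_bound g (B : set (borel K)) : measurable B ->
  phi g <= fprob nuK (~` B) + fprob nuK (b g @^-1` B).
Proof.
move=> mB.
have [la [la_reg laU]] := regularization Kc Kh theta_ge0 thetaU thetaT.
have la_inner (U : set K) : open U -> fprob la U = inner theta U.
  by move=> oU; rewrite /fprob laU.
have outer_reg (A : set (borel K)) e : measurable A -> 0 < e ->
    exists U : set K, [/\ open U, A `<=` U & fprob la U < fprob la A + e].
  move=> mA e0; have [_ Ainf] := la_reg A mA.
  have : (la A < la A + e%:E)%E.
    by rewrite -(fprobE la mA) -EFinD lte_fin ltrDl.
  rewrite {1}Ainf => /ereal_inf_lt[_ [U [oU AU] <-] UA]; exists U; split => //.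
  by move: UA; rewrite -(fprobE la mA) -(fprobE la (borel_open_measurable oU)) -EFinD lte_fin.
have la_sub (A : set (borel K)) : measurable A -> gmean mu (fun h => fprob la (b h @^-1` A)) <= fprob la A.
  move=> mA; apply/ler_addgt0Pr => e e0; have [U [oU AU UE]] := outer_reg A e mA e0.
  apply: le_trans (ltW UE); rewrite (la_inner _ oU).
  apply: le_trans (inner_st oU); apply: gmean_le => // h.
  - by apply: fprob_unit; exact: b_mpre.
  - rewrite -(la_inner _ (b_open h oU)).
    by apply: fprob_le => [||x /AU//]; apply: b_mpre => //; exact: borel_open_measurable.
have la_st : @stationary R G mu _ (borel K) b la.
  move=> A mA.
  have la01 h : 0 <= fprob la (b h @^-1` A) <= 1 by apply: fprob_unit; exact: b_mpre.
  rewrite -(fprobE la mA) (_ : esum _ _ =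
      \esum_(h in [set: G]) (mu h * fprob la (b h @^-1` A))%:E); last first.
    by apply: eq_esum => h _; rewrite EFinM fprobE//; exact: b_mpre.
  rewrite gmean_esum//; congr EFin; apply/eqP; rewrite eq_le la_sub//=.
  (* The same inequality for the complement is the reverse one, since [mu] has total mass 1. *)
  have := la_sub _ (measurableC mA); rewrite (fprobC la mA).
  have -> : (fun h => fprob la (b h @^-1` (~` A))) = (fun h => 1 - fprob la (b h @^-1` A)).
    by apply/funext => h; rewrite preimage_setC fprobC//; exact: b_mpre.
  by rewrite gmean_onem// lerD2l lerN2.
have la_nuK (A : set (borel K)) : measurable A -> fprob la A = fprob nuK A.
  by move=> mA; rewrite /fprob; have [_ ->] := hK.
rewrite -!la_nuK; [|exact: b_mpre|exact: measurableC].
apply/ler_addgt0Pr => e e0; have e20 : 0 < e / 2 by rewrite divr_gt0.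
have [C [cC CB CE]] : exists C : set K,
    [/\ closed C, C `<=` B & fprob la B - e / 2 < fprob la C].
  have [Bsup _] := la_reg B mB.
  have : (la B - (e / 2)%:E < la B)%E.
    by rewrite -(fprobE la mB) -EFinB lte_fin ltrBlDr ltrDl.
  rewrite {2}Bsup => /ereal_sup_gt[_ [C [cC CB] <-] UA].
  have clC : closed C by exact: compact_closed.
  have mC : measurable (C : set (borel K)) by exact: borel_closed_measurable.
  exists C; split => //.
  by move: UA; rewrite -(fprobE la mB) -(fprobE la mC) -EFinB lte_fin.
have mC : measurable (C : set (borel K)) by exact: borel_closed_measurable.
have [V [oV CV VE]] := outer_reg _ _ (b_mpre g mC) e20.
(* [C] ⊂ [Q] ⊂ closure of [W] ⊂ gV: the content [theta] compares with the measure only through a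
   closed set inside an open one. *)
have [|W /set_nbhsP[Q [oQ CQ QW]] WV] :=
    compact_normal Kh Kc cC (t := b g^-1%g @^-1` V).
  apply/set_nbhsP; exists (b g^-1%g @^-1` V); split => //; first exact: b_open.
  by move=> x Cx; apply: CV; rewrite /= bKV.
have H1 : p g [set s | ~ Q (b s point)] <= fprob la (~` C).
  apply: le_trans (cfam_le hp _ _) _.
  rewrite la_inner; last exact: closed_openC.
  apply: (theta_inner theta_ge0 thetaU thetaT (C := ~` Q)); first exact: open_closedC.
  exact: subsetC.
have H2 : p g [set s | Q (b s point)] <= fprob la V.
  rewrite -(cfam_inv hp) (la_inner _ oV); apply: le_trans (cfam_le hp _ _) _.
  apply: (@le_trans _ _ (theta (b g @^-1` closure W))).
    by apply: (cfam_mono hp) => s /=; rewrite bM => /QW/subset_closure.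
  apply: (theta_inner theta_ge0 thetaU thetaT); first by apply: b_closed; exact: closed_closure.
  by move=> x /WV /=; rewrite bVK.
have H3 : fprob la (b g @^-1` C) <= fprob la (b g @^-1` B).
  by apply: fprob_le => [||x /CB//]; exact: b_mpre.
have -> : phi g = p g [set s | ~ Q (b s point)] + p g [set s | Q (b s point)].
  rewrite -(cfamU hp).
    rewrite -(cfamT hp); congr p; apply/seteqP; split=> // s _.
    by have [?|?] := pselect (Q (b s point)); [right|left].
  by rewrite -subset0 => s [].
move: H1; rewrite !fprobC//; move: H2 H3 CE VE; lra.
Qed.

End unique_stationary.

(** * Compact models *)

Section compact_model.
Context (R : realType) (G : groupType).

Lemma fprob_ae_eq d (T : measurableType d) (P : probability T R) (A B : set T) :
  measurable A -> measurable B -> {ae P, forall x, A x <-> B x} ->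
  fprob P A = fprob P B.
Proof.
move=> mA mB AB.
have H (C D : set T) : measurable C -> measurable D ->
    {ae P, forall x, C x <-> D x} -> fprob P C <= fprob P D.
  move=> mC mD CD; have mCD : measurable (C `&` ~` D).
    by apply: measurableI => //; exact: measurableC.
  have mCI : measurable (C `&` D) by exact: measurableI.
  have dj : (C `&` D) `&` (C `&` ~` D) = set0.
    by rewrite -subset0 => x [[_ Dx] [_ nDx]].
  have E : C = (C `&` D) `|` (C `&` ~` D) by rewrite -setIUr setUCr setIT.
  rewrite E (fprobU _ mCI mCD dj).
  rewrite (fprob0 mCD) ?addr0; first by apply: fprob_le.
  by apply: negligibleS CD => x [Cx nDx] /= [/(_ Cx)].
apply/eqP; rewrite eq_le !H//.
by apply: negligibleS AB; apply: subsetC => x /= [? ?]; split.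
Qed.

Variables (dY : measure_display) (Y : measurableType dY) (a : G -> Y -> Y)
  (eta : probability Y R) (hY : measurable_action a eta).

Let a_pre g (A : set Y) : measurable A -> measurable (a g @^-1` A).
Proof.
by move=> mA; have [_ /(_ g) am _] := hY; rewrite -[X in measurable X]setTI; exact: am.
Qed.

Let ae_translate g (P : set Y) : {ae eta, forall y, P y} -> {ae eta, forall y, P (a g y)}.
Proof.
move=> [N [mN N0 PN]]; exists (a g @^-1` N); split; first exact: a_pre.
  by have [_ _ ns] := hY; apply/(ns g N mN).
by move=> y /PN.
Qed.

Variables (K : ptopologicalType) (b : G -> K -> K) (nu : probability (borel K) R).
Hypothesis hb : compact_space_action b.
Variables (f : Y -> K) (h : K -> Y).
Hypothesis mf : measurable_fun [set: Y] (f : Y -> borel K).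
Hypothesis mh : measurable_fun [set: borel K] (h : borel K -> Y).
Hypothesis fnu : forall A : set (borel K), measurable A ->
  @pushforward _ _ Y (borel K) R eta f A = nu A.
Hypothesis hf : {ae eta, forall y, h (f y) = y}.
Hypothesis fe : {ae eta, forall y, forall g, f (a g y) = b g (f y)}.

Let f_pre (A : set (borel K)) : measurable A -> measurable (f @^-1` A).
Proof. by move=> mA; rewrite -[X in measurable X]setTI; exact: mf. Qed.
Let h_pre (A : set Y) : measurable A -> measurable (h @^-1` A : set (borel K)).
Proof. by move=> mA; rewrite -[X in measurable X]setTI; exact: mh. Qed.

Lemma model_fprob (A : set (borel K)) : measurable A -> fprob nu A = fprob eta (f @^-1` A).
Proof. by move=> mA; rewrite /fprob -fnu. Qed.

Lemma model_fprob_action g (A : set (borel K)) : measurable A ->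
  fprob nu (b g @^-1` A) = fprob eta (a g @^-1` (f @^-1` A)).
Proof.
move=> mA; have mbA := borel_action_preimage hb g mA; rewrite model_fprob//.
apply: fprob_ae_eq; [exact: f_pre|by apply: a_pre; exact: f_pre|].
by apply: filterS fe => y /(_ g) /= ->.
Qed.

(** Complements [model_fprob]: sets can be pulled back in both directions, so an inequality between
    masses of sets and of their translates passes from one model to another through [eta]. *)
Lemma model_lift (A : set Y) : measurable A -> fprob nu (h @^-1` A) = fprob eta A.
Proof.
move=> mA; rewrite model_fprob; last exact: h_pre.
apply: fprob_ae_eq => //; first by apply: f_pre; exact: h_pre.
by apply: filterS hf => y /= ->.
Qed.

Lemma model_lift_action g (A : set Y) : measurable A ->
  fprob nu (b g @^-1` (h @^-1` A)) = fprob eta (a g @^-1` A).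
Proof.
move=> mA; rewrite model_fprob_action; last exact: h_pre.
apply: fprob_ae_eq; [by apply: a_pre; apply: f_pre; exact: h_pre|exact: a_pre|].
by apply: filterS (ae_translate g hf) => y /= ->.
Qed.

(** Almost surely [h] recovers both y and gy from their images under [f], so a fixed image f y would
    force gy = y. *)
Lemma fixpoints_null g : essentially_free [set: G] a eta -> g <> 1%g ->
  fprob nu [set x | b g x = x] = 0.
Proof.
move=> free g1.
have mF : measurable ([set x | b g x = x] : set (borel K)).
  by apply: borel_closed_measurable; exact: (fixpoints_closed hb).
rewrite model_fprob//; apply: fprob0; first exact: f_pre.
have H : {ae eta, forall y, [/\ h (f y) = y, h (f (a g y)) = a g y,
    f (a g y) = b g (f y) & a g y <> y]}.
  have fr : {ae eta, forall y, a g y <> y}.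
    by apply: negligibleS (free g I g1) => y; exact: contrapT.
  have fe' : {ae eta, forall y, f (a g y) = b g (f y)} by apply: filterS fe => y.
  have E : {ae eta, forall y, h (f (a g y)) = a g y} := ae_translate g hf.
  apply: filterS2 (filterI E fr) (filterI hf fe') => y [? ?] [? ?].
  by split.
apply: negligibleS H => y /= bf [hfy hfgy fgy]; apply.
by rewrite -hfgy fgy bf.
Qed.

End compact_model.

(** * Expectations along the random walk *)

Section countable_valued.
Context (R : realType) (G : groupType) (cG : countable [set: G]).
Context d (Omega : measurableType d) (P : probability Omega R).

Definition measurable_fibers (X : Omega -> G) :=
  forall s, measurable [set w | X w = s].

Lemma fibers_preimage (X : Omega -> G) (S : set G) :
  measurable_fibers X -> measurable (X @^-1` S).
Proof.
move=> mX; rewrite (_ : _ @^-1` _ = \bigcup_(s in S) [set w | X w = s]).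
  by apply: (countable_bigcup_measurable 1%g) => // s _; exact: mX.
apply/seteqP; split=> w; first by move=> Sw; exists (X w).
by move=> [s Ss Xs]; rewrite /preimage /= (Xs : X w = s).
Qed.

Lemma fibers_measurable_fun (X : Omega -> G) d' (T : measurableType d')
    (F : G -> T) (D : set Omega) :
  measurable_fibers X -> measurable_fun D (fun w => F (X w)).
Proof.
move=> mX mD B mB; apply: measurableI => //.
exact: (fibers_preimage (F @^-1` B)).
Qed.

(** An injection of [G] into [nat] turns the fibres into a disjoint sequence; indices off its range
    give empty sets. *)
Lemma integral_fibers (X : Omega -> G) (D : set Omega) (f : Omega -> \bar R) :
  measurable_fibers X -> measurable D -> measurable_fun D f ->
  (forall w, 0 <= f w)%E ->
  (\int[P]_(w in D) f w =
   \esum_(s in [set: G]) \int[P]_(w in D `&` [set w | X w = s]) f w)%E.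
Proof.
move=> mX mD mf f0; have /countable_injP[code codeI] := cG.
pose F n := D `&` [set w | code (X w) = n].
have mF n : measurable (F n).
  by apply: measurableI => //; exact: (fibers_preimage [set s | code s = n]).
have UF : \bigcup_n F n = D.
  by apply/seteqP; split=> [w [n _ []//]|w Dw]; exists (code (X w)).
rewrite -{1}UF ge0_integral_bigcup//; last 2 first.
- by rewrite UF.
- by move=> i j _ _ [w [[_ /= <-] [_ /= <-]]].
rewrite nneseries_esumT; last by move=> n; exact: integral_ge0.
rewrite (esumID (range code)); last by move=> n _; exact: integral_ge0.
rewrite [X in (_ + X)%E]esum1 ?adde0; last first.
  move=> n /= [_ nc]; rewrite (_ : F n = set0) ?integral_set0//.
  by rewrite -subset0 => w [_ /= E]; apply: nc; exists (X w).
rewrite setTI esum_image; last by move=> x y _ _; apply: codeI; rewrite in_setT.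
apply: eq_esum => s _; congr integral; apply/seteqP; split=> w [Dw /= E]; split=> //=.
  by apply: codeI; rewrite ?in_setT.
by rewrite E.
Qed.

End countable_valued.

(** One inequality comes from finite partial sums; the other is the same one for the factor
    [c^-1]. *)
Lemma esum_scale (R : realType) (I : choiceType) (c : R) (a : I -> R) :
  0 <= c -> (forall i, 0 <= a i) ->
  \esum_(i in [set: I]) (c * a i)%:E = (c%:E * \esum_(i in [set: I]) (a i)%:E)%E.
Proof.
have H (x : R) (f : I -> R) : 0 <= x -> (forall i, 0 <= f i) ->
    (\esum_(i in [set: I]) (x * f i)%:E <= x%:E * \esum_(i in [set: I]) (f i)%:E)%E.
  move=> x0 f0; apply: ge_ereal_sup => _ [F [finF _] <-].
  rewrite fsbig_finite//= sumEFin -mulr_sumr EFinM lee_wpmul2l ?lee_fin//.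
  by rewrite -sumEFin; apply: esum_ge; exists F => //; rewrite fsbig_finite.
rewrite le_eqVlt => /predU1P[<-|c0] a0.
  by rewrite mul0e esum1// => i _; rewrite mul0r.
apply/eqP; rewrite eq_le H ?(ltW c0)//=.
have Hi : (\esum_(i in [set: I]) (c^-1 * (c * a i))%:E <=
    c^-1%:E * \esum_(i in [set: I]) (c * a i)%:E)%E.
  apply: (H c^-1 (fun i => c * a i)); first by rewrite invr_ge0 ltW.
  by move=> i; rewrite mulr_ge0// ltW.
have c0E : (0 <= c%:E)%E by rewrite lee_fin ltW.
have := lee_wpmul2l c0E Hi; rewrite muleA -EFinM divff ?gt_eqF// mul1e.
by under eq_esum do rewrite mulKf ?gt_eqF//.
Qed.

Section walk_expectation.
Context (R : realType) (G : groupType) (cG : countable [set: G]).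
Variables (mu : G -> R) (hmu : prob_on_group mu).
Context d (Omega : measurableType d) (P : probability Omega R).
Variables (xi : nat -> Omega -> G) (hxi : iid mu P xi).

Lemma walkS w k : walk xi w k.+1 = (walk xi w k * xi k w)%g.
Proof. by rewrite /walk big_ord_recr. Qed.

Lemma walk_fibers k : measurable_fibers (walk xi ^~ k).
Proof.
elim: k => [|k IH] s.
  rewrite (_ : [set w | _] = if `[< s = 1%g >] then setT else set0); first by case: ifP.
  by apply/seteqP; split=> w /=; rewrite /walk big_ord0; case: asboolP => [->//|ns] // E;
    case: ns.
rewrite (_ : [set w | _] = \bigcup_t ([set w | walk xi w k = (s * t^-1)%g] `&`
    [set w | xi k w = t])).
  apply: (countable_bigcup_measurable 1%g) => // t _; apply: measurableI; first exact: IH.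
  by have [+ _] := hxi; exact.
apply/seteqP; split=> w /=; rewrite walkS.
  by move=> <-; exists (xi k w) => //; split=> //=; rewrite mulgK.
by move=> [t _ [/= -> ->]]; rewrite mulgVK.
Qed.

Variable psi : G -> R.
Hypothesis psi01 : forall h, 0 <= psi h <= 1.
Hypothesis psi_harmonic : forall h, gmean mu (fun s => psi (h * s)%g) = psi h.

Let prefix n (s : nat -> G) : set Omega := [set w | forall i : 'I_n, xi i w = s i].

Let prefix_measurable n s : measurable (prefix n s).
Proof.
rewrite (_ : prefix n s = \bigcap_(i < n) [set w | xi i w = s i]).
  by apply: bigcap_measurableType => i _; have [+ _] := hxi; exact.
by apply/seteqP; split=> w H i; [move=> /= Hi; exact: (H (Ordinal Hi))|exact: (H i (ltn_ord i))].
Qed.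

Let prefix_P n s : P (prefix n s) = (\prod_(i < n) mu (s i))%:E.
Proof. by have [_ H] := hxi; exact: (H n (fun i : 'I_n => s i)). Qed.

Let set_last (s : nat -> G) n t : nat -> G := fun i => if i == n then t else s i.

Let walk_prefix n s w : prefix n s w -> walk xi w n = (\prod_(i < n) s i)%g.
Proof. by move=> H; apply: eq_bigr => i _; exact: H. Qed.

(** Induction on the number [r] of remaining steps: fixing the value of the next increment lengthens
    the prefix by one, and harmonicity of [psi] sums over that value. *)
Let expectation_prefix r n s :
  (\int[P]_(w in prefix n s) (psi (walk xi w (n + r)))%:E =
   ((\prod_(i < n) mu (s i)) * psi (\prod_(i < n) s i)%g)%:E)%E.
Proof.
elim: r n s => [|r IH] n s.
  rewrite (eq_integral (cst (psi (\prod_(i < n) s i)%g)%:E)).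
    transitivity ((psi (\prod_(i < n) s i)%g)%:E * P (prefix n s))%E.
      exact: integral_cst.
    by rewrite prefix_P -EFinM mulrC.
  by move=> w /set_mem/walk_prefix; rewrite addn0 => ->.
rewrite (integral_fibers cG P (X := xi n)) => //; last 3 first.
- by have [H _] := hxi; exact: H.
- apply/measurable_EFinP; apply: (fibers_measurable_fun cG psi).
  exact: walk_fibers.
- by move=> w; rewrite lee_fin; case/andP: (psi01 (walk xi w (n + r.+1))).
have E t : (\int[P]_(w in prefix n s `&` [set w | xi n w = t])
     (psi (walk xi w (n + r.+1)))%:E =
   ((\prod_(i < n) mu (s i)) * (mu t * psi ((\prod_(i < n) s i) * t)%g))%:E)%E.
  have -> : prefix n s `&` [set w | xi n w = t] = prefix n.+1 (set_last s n t).
    apply/seteqP; split=> w.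
      move=> [H Hn] i; rewrite /set_last; case: eqP => [->//|/eqP ni].
      have li : (i < n)%N by rewrite ltn_neqAle ni -ltnS ltn_ord.
      exact: (H (Ordinal li)).
    move=> H; split=> [i|/=]; last by rewrite (H ord_max) /set_last eqxx.
    have /= := H (widen_ord (leqnSn n) i); rewrite /set_last /=.
    by rewrite ltn_eqF.
  rewrite addnS -addSn IH !big_ord_recr/= /set_last eqxx mulrA.
  by congr (_ * _ * psi (_ * _)%g)%:E;
    apply: eq_bigr => i _; rewrite ltn_eqF.
under eq_esum => t _ do rewrite E.
have c0 : 0 <= \prod_(i < n) mu (s i) by apply: prodr_ge0 => i _; exact: hmu.1.
rewrite -[X in psi X]mulg1 -(psi_harmonic (\prod_(i < n) s i * 1)%g) mulg1.
rewrite EFinM -gmean_esum// -esum_scale// => t.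
by rewrite mulr_ge0 ?hmu.1//; case/andP: (psi01 (\prod_(i < n) s i * t)%g).
Qed.

Lemma walk_expectation k : (\int[P]_w (psi (walk xi w k))%:E = (psi 1%g)%:E)%E.
Proof.
have := expectation_prefix k 0 (fun=> 1%g).
rewrite !big_ord0 add0n mul1r (_ : prefix 0 _ = setT)//.
by apply/seteqP; split=> // w _ [].
Qed.

End walk_expectation.

(** * Escape of mass along the boundary *)

Lemma stationary_gmean (R : realType) (G : groupType) (mu : G -> R) d
    (T : measurableType d) (a : G -> T -> T) (eta : probability T R) (A : set T) :
  prob_on_group mu -> stationary mu a eta -> measurable A ->
  (forall g, measurable (a g @^-1` A)) ->
  gmean mu (fun h => fprob eta (a h @^-1` A)) = fprob eta A.
Proof.
move=> hmu st mA maA; apply: EFin_inj; rewrite -gmean_esum//; last first.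
  by move=> h; exact: fprob_unit.
rewrite fprobE// -st//; apply: eq_esum => h _; rewrite EFinM.
by congr (_ * _)%E; exact: (fprobE eta (maA h)).
Qed.

Section boundary.
Context (R : realType) (G : groupType) (cG : countable [set: G]).
Variables (mu : G -> R) (hmu : prob_on_group mu).
Variables (Z : ptopologicalType) (c : G -> Z -> Z) (zeta : probability (borel Z) R).
Hypothesis hc : compact_space_action c.
Hypothesis zst : @stationary R G mu _ (borel Z) c zeta.
Hypothesis zreg : regular_borel zeta.

Let Zc : compact [set: Z]. Proof. by have [] := hc. Qed.
Let Zh : hausdorff_space Z. Proof. by have [] := hc. Qed.
Let cM g h x : c (g * h)%g x = c g (c h x). Proof. by have [_ _ [_ ->] _] := hc. Qed.
Let closed_z (z : Z) : closed [set z].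
Proof. by apply: accessible_closed_set1; exact: hausdorff_accessible. Qed.

Let c_closed g (C : set Z) : closed C -> closed (c g @^-1` C).
Proof. by have [_ _ _ /(_ g)/continuous_closedP] := hc; exact. Qed.
Let c_m g (A : set (borel Z)) : measurable A -> measurable (c g @^-1` A : set (borel Z)).
Proof. exact: (borel_action_preimage hc). Qed.

Lemma continuous_borel_measurable (f : Z -> R) : continuous f ->
  measurable_fun [set: borel Z] (f : borel Z -> R).
Proof.
move=> cf; apply: (@measurability _ _ (borel Z) R setT f _ (RGenOInfty.measurableE R)).
move=> _ [_ [r ->] <-]; rewrite setTI; apply: borel_open_measurable.
by move/continuousP : cf; apply; exact: rray_open.
Qed.

(** A Urysohn function vanishing at [z] and equal to 1 on [C] dominates the indicator of [C], and
    its integrals tend to its value at [z]. *)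
Lemma weak_star_closed (hs : nat -> G) (z : Z) (C : set Z) :
  weak_star_cvg (fun k => @pushforward _ _ (borel Z) (borel Z) R zeta (c (hs k)))
    (@dirac _ (borel Z) z R) ->
  closed C -> ~ C z ->
  (fun k => fprob zeta (c (hs k) @^-1` C)) @ \oo --> (0 : R).
Proof.
move=> H cC nCz.
have /(uniform_separatorP (R := R))[u [cu u01 u0 u1]] : uniform_separator [set z] C.
  apply: (normal_uniform_separator (compact_normal Zh Zc)) => //.
  by rewrite -subset0 => x [-> ].
have mu_ := continuous_borel_measurable cu.
have u_ge0 x : 0 <= u x.
  by have := u01 (u x) (ex_intro2 _ _ x I erefl); rewrite /= in_itv/= => /andP[].
have mC : measurable (C : set (borel Z)) by exact: borel_closed_measurable.
have uz : u z = 0 by apply: (u0 (u z)); exists z.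
have uC x : C x -> u x = 1 by move=> Cx; apply: (u1 (u x)); exists x.
have muE : measurable_fun [set: borel Z] (fun x : borel Z => (u x)%:E).
  exact/measurable_EFinP.
have := H u cu; rewrite (@integral_dirac _ (borel Z) z R setT)// diracT mul1e uz.
under [X in X @ _ --> _ -> _]eq_fun => k.
  rewrite (@ge0_integral_pushforward _ _ (borel Z) (borel Z) R (c (hs k)))//; last first.
  - by move=> x _; rewrite lee_fin.
  - by move=> _ A mA; rewrite setTI; exact: c_m.
  over.
move=> Hcv.
suff : (fun k => (fprob zeta (c (hs k) @^-1` C))%:E) @ \oo --> 0%:E.
  by move/fine_cvgP => [_].
apply: (squeeze_cvge _ (cvg_cst 0%E) Hcv); apply: nearW => k.
have mcC : measurable (c (hs k) @^-1` C : set (borel Z)) by exact: c_m.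
rewrite lee_fin; have /andP[-> _] /= := fprob_unit zeta mcC.
rewrite fprobE// -[X in (zeta X <= _)%E]setIT -integral_indic//.
apply: ge0_le_integral => //.
- by apply/measurable_EFinP; exact: measurable_indic.
- by apply/measurable_EFinP; apply: continuous_borel_measurable => x;
    apply: continuous_comp; [have [_ _ _] := hc; exact|exact: cu].
- move=> x _; rewrite lee_fin /= indicE; case: (asboolP (C (c (hs k) x))) => [Cx|nCx].
    by rewrite mem_set//= uC.
  by rewrite memNset.
Qed.

Variable phi : G -> R.
Hypothesis phi01 : forall g, 0 <= phi g <= 1.
Hypothesis phiJ : forall g, gmean mu (fun h => phi (h^-1 * g * h)%g) = phi g.
Hypothesis phi_bound : forall g (B : set (borel Z)), measurable B ->
  phi g <= fprob zeta (~` B) + fprob zeta (c g @^-1` B).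
Context d (Omega : measurableType d) (P : probability Omega R).
Variables (xi : nat -> Omega -> G) (hxi : iid mu P xi).
Hypothesis xi_cvg : {ae P, forall w, exists z : Z,
  weak_star_cvg (fun k => @pushforward _ _ (borel Z) (borel Z) R
    zeta (c (walk xi w k))) (@dirac _ (borel Z) z R)}.

(** The part of [phi] at the conjugate of g that the mass of h^-1 U does not account for, truncated
    at 0 so that it takes values in [0,1]. *)
Let excess g (U : set Z) h : R :=
  Num.max (phi (h^-1 * g * h)%g - fprob zeta (c h @^-1` U)) 0.

(* If g moves the limit point z, then [phi_bound] for the conjugates of g by the
   walk, with B the translate of a small neighbourhood of z, sends phi to 0; if g
   fixes z, then the mass of U tends to 1. *)
Let excess_cvg g (U : set Z) (hs : nat -> G) (z : Z) : open U ->
  [set z | c g z = z] `<=` U ->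
  weak_star_cvg (fun k => @pushforward _ _ (borel Z) (borel Z) R zeta (c (hs k)))
    (@dirac _ (borel Z) z R) ->
  excess g U (hs k) @[k --> \oo] --> (0 : R).
Proof.
move=> oU FU H; have mU : measurable (U : set (borel Z)) by exact: borel_open_measurable.
suff [C1 [C2 [cC1 nC1 cC2 nC2 HC]]] : exists C1 C2 : set Z,
    [/\ closed C1, ~ C1 z, closed C2, ~ C2 z & forall h, excess g U h <=
      fprob zeta (c h @^-1` C1) + fprob zeta (c h @^-1` C2)].
  apply: (@squeeze_cvgr _ _ _ _ (fun=> 0)
    (fun k => fprob zeta (c (hs k) @^-1` C1) + fprob zeta (c (hs k) @^-1` C2)) _).
  - by apply: nearW => k; rewrite HC andbT le_max lexx orbT.
  - exact: cvg_cst.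
  - by rewrite -[X in _ --> X]addr0; apply: cvgD; exact: (weak_star_closed H).
have fp0 h (C : set Z) : closed C -> 0 <= fprob zeta (c h @^-1` C).
  move=> cC; have mC : measurable (c h @^-1` C : set (borel Z)).
    by apply: c_m; exact: borel_closed_measurable.
  by case/andP: (fprob_unit zeta mC).
have [gz|gz] := pselect (c g z = z).
  exists (~` U), set0; split => //.
  - exact: open_closedC.
  - by apply; exact: FU.
  - exact: closed0.
  - move=> h; apply: (@le_trans _ _ (fprob zeta (c h @^-1` (~` U)))); last first.
      by rewrite lerDl; apply: fp0; exact: closed0.
    have /andP[_ ?] := phi01 (h^-1 * g * h)%g.
    have mcU := c_m h mU.
    rewrite preimage_setC fprobC// ge_max; have /andP[_ ?] := fprob_unit zeta mcU.
    by apply/andP; split; lra.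
have [W [oW Wz nW]] : exists W : set Z, [/\ open W, W z & ~ closure W (c g z)].
  have [|W' /set_nbhsP[W [oW zW WW']] W'g] :=
      compact_normal Zh Zc (@closed_z z) (t := ~` [set c g z]).
    apply/set_nbhsP; exists (~` [set c g z]); split => //.
      exact: closed_openC.
    by move=> x -> E; apply: gz.
  exists W; split => //; first exact: zW.
  by move=> /(closure_subset WW')/W'g; apply.
exists (~` W), (c g @^-1` closure W); split => //.
- exact: open_closedC.
- by apply: c_closed; exact: closed_closure.
move=> h; have mW : measurable (W : set (borel Z)) by exact: borel_open_measurable.
have cWc : closed (~` W) by exact: open_closedC.
have cW : closed (c g @^-1` closure W) by apply: c_closed; exact: closed_closure.
rewrite /excess ge_max; apply/andP; split; last by rewrite addr_ge0 ?fp0.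
have mchU := c_m h mU.
apply: (@le_trans _ _ (phi (h^-1 * g * h)%g)).
  by rewrite gerBl; case/andP: (fprob_unit zeta mchU).
(* With B = h^-1 W, the preimage of B under h^-1 g h is h^-1 g^-1 W. *)
apply: le_trans (phi_bound _ (c_m h mW)) _; rewrite lerD//.
apply: fprob_le.
- by apply: c_m; exact: c_m.
- by apply: c_m; exact: borel_closed_measurable.
move=> x /=; rewrite -!cM !mulgA mulgV mul1g.
exact: subset_closure.
Qed.

(** Choose an open [U] of mass below e around the fixed points. Along the walk, [S] and [V] have
    constant expectations [phi g] and the mass of [U], and S ≤ D + V. As the expectation of [D]
    tends to 0 by dominated convergence, [phi g] is at most the mass of [U]. *)
Lemma boundary_vanishing g : fprob zeta [set z | c g z = z] = 0 -> phi g = 0.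
Proof.
move=> F0; apply/eqP; rewrite eq_le; case/andP: (phi01 g) => -> _; rewrite andbT.
apply/ler_addgt0Pr => e e0; rewrite add0r.
have mF : measurable ([set z | c g z = z] : set (borel Z)).
  by apply: borel_closed_measurable; exact: (fixpoints_closed hc).
have [U [oU FU Ue]] : exists U : set Z,
    [/\ open U, [set z | c g z = z] `<=` U & fprob zeta U < e].
  have [_ Finf] := zreg mF.
  have : (zeta [set z | c g z = z] < e%:E)%E by rewrite -fprobE// F0 lte_fin.
  rewrite {1}Finf => /ereal_inf_lt[_ [U [oU FU] <-] Ue]; exists U; split => //.
  by rewrite -lte_fin fprobE//; exact: borel_open_measurable.
have mU : measurable (U : set (borel Z)) by exact: borel_open_measurable.
pose S h := phi (h^-1 * g * h)%g.
pose V h := fprob zeta (c h @^-1` U).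
have V01 h : 0 <= V h <= 1 by apply: fprob_unit; exact: c_m.
have ES k : (\int[P]_w (S (walk xi w k))%:E = (phi g)%:E)%E.
  rewrite (walk_expectation cG hmu hxi) /S ?invg1 ?mul1g ?mulg1// => h.
  rewrite -[RHS]phiJ; congr gmean; apply/funext => s; congr phi.
  by rewrite invgM !mulgA.
have EV k : (\int[P]_w (V (walk xi w k))%:E = (fprob zeta U)%:E)%E.
  rewrite (walk_expectation cG hmu hxi)//.
    by congr (fprob zeta _)%:E; apply/seteqP; split=> x;
      have [_ _ [c1 _] _] := hc; rewrite /= c1.
  move=> h; have -> : V h = gmean mu (fun s => fprob zeta (c s @^-1` (c h @^-1` U))).
    have mchU := c_m h mU.
    rewrite -[LHS](@stationary_gmean R G mu _ (borel Z) c zeta _ hmu zst mchU)//.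
    by move=> s; exact: c_m.
  by congr gmean; apply/funext => s; congr fprob; apply/seteqP; split=> x /=; rewrite cM.
pose D h := excess g U h.
have D01 h : 0 <= D h <= 1.
  have /andP[? ?] := phi01 (h^-1 * g * h)%g; have /andP[? ?] := V01 h.
  rewrite /D /excess -/(V h) le_max lexx orbT/= ge_max.
  by apply/andP; split; lra.
have mw (F : G -> R) k : measurable_fun [set: Omega] (fun w => (F (walk xi w k))%:E).
  apply/measurable_EFinP; apply: (fibers_measurable_fun cG F).
  exact: (walk_fibers cG hxi).
have Dw w : (exists z : Z, weak_star_cvg
      (fun k => @pushforward _ _ (borel Z) (borel Z) R zeta (c (walk xi w k)))
      (@dirac _ (borel Z) z R)) ->
    (fun k => (D (walk xi w k))%:E) @ \oo --> 0%E.
  by move=> [z Hz]; apply: cvg_EFin; [exact: nearW|exact: (excess_cvg oU FU Hz)].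
have Dle w k : (`|(D (walk xi w k))%:E| <= 1)%E.
  by have /andP[? ?] := D01 (walk xi w k); rewrite abse_EFin ger0_norm.
have SDV k : ((phi g)%:E <= \int[P]_w (D (walk xi w k))%:E + (fprob zeta U)%:E)%E.
  rewrite -(ES k) -(EV k) -ge0_integralD//.
  - apply: ge0_le_integral => //.
    + by move=> w _; rewrite lee_fin; case/andP: (phi01 ((walk xi w k)^-1 * g * walk xi w k)%g).
    + by apply: emeasurable_funD; [exact: (mw D k)|exact: (mw V k)].
    + move=> w _; rewrite -EFinD lee_fin -lerBlDr /D /excess le_max.
      by rewrite -/(V _) -/(S _) lexx.
  - by move=> w _; rewrite lee_fin; case/andP: (D01 (walk xi w k)).
  - by move=> w _; rewrite lee_fin; case/andP: (V01 (walk xi w k)).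
have [_ _ Dcv] := @dominated_convergence _ Omega R P setT measurableT
  (fun k w => (D (walk xi w k))%:E) (cst 0%E) (cst 1%E)
  (fun k => mw D k) (measurable_cst _)
  (filterS (fun w Hw _ => Dw w Hw) xi_cvg)
  (finite_measure_integrable_cst P 1 measurableT)
  (aeW P (fun w k _ => Dle w k)).
rewrite -lee_fin; apply: (@le_trans _ _ (fprob zeta U)%:E); last by rewrite lee_fin ltW.
have : (fun k => \int[P]_w (D (walk xi w k))%:E + (fprob zeta U)%:E)%E @ \oo -->
    (0 + (fprob zeta U)%:E)%E.
  apply: cvgeD => //; last exact: cvg_cst.
  by move: Dcv; rewrite integral0.
rewrite add0e => Hc; rewrite -(cvg_lim _ Hc)//; apply: lime_ge; last exact: nearW.
by apply/cvg_ex; exists (fprob zeta U)%:E.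
Qed.

End boundary.

(** * Transport of the bound from the uniquely stationary model to the boundary *)

Theorem mainTheorem9 (R : realType) (G : groupType) (hG : countable [set: G])
  (mu : G -> R) (hmu : prob_on_group mu)
  (hB : exists (dY : measure_display) (Y : measurableType dY)
          (aY : G -> Y -> Y) (eta : probability Y R),
      [/\ mu_boundary mu aY eta,
          essentially_free [set: G] aY eta &
          exists (K : ptopologicalType) (b : G -> K -> K)
            (nuK : probability (borel K) R),
            compact_model aY eta b nuK /\ uniquely_stationary mu b nuK])
  (dX : measure_display) (X : measurableType dX) (aX : G -> X -> X)
  (nu : probability X R)
  (hX : measurable_action aX nu)
  (hXfix : measurable_fixpoints aX)
  (hXst : stationary mu aX nu)
  (L : set G) (hL : subgroup L) (hLco : coamenable R L)
  (hLfree : essentially_free L aX nu) :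
  essentially_free [set: G] aX nu.
Proof.
move=> g _ g1; apply/negligibleP; first exact: hXfix.
apply: etrans (esym (fprobE nu (hXfix g))) _; congr EFin.
pose phi g := fprob nu [set x | aX g x = x].
have phi01 h : 0 <= phi h <= 1 by apply: fprob_unit; exact: hXfix.
have [[aX1 aXM] maX _] := hX.
have phi1 : phi 1%g = 1.
  by rewrite -(fprobT nu); congr fprob; apply/seteqP; split=> x //= _; exact: aX1.
have pre_fix h k : aX h @^-1` [set x | aX k x = x] = [set x | aX (h^-1 * k * h)%g x = x].
  apply/seteqP; split=> x /=; rewrite !aXM; first by move=> ->; rewrite -aXM mulVg aX1.
  by move=> E; rewrite -[in RHS]E -[RHS]aXM mulgV aX1.
have phiJ k : gmean mu (fun h => phi (h^-1 * k * h)%g) = phi k.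
  rewrite -[RHS](stationary_gmean hmu hXst (hXfix k)).
    by congr gmean; apply/funext => h; rewrite pre_fix.
  by move=> h; rewrite pre_fix; exact: hXfix.
have [m hm m_inv] := coamenable_mean hL hLco.
have [p0 hp0] := initial_cfam hG hL hm m_inv hX hXfix hLfree.
have [p hp pst] := stationary_cfam hmu phi01 phiJ hp0.
have [dY [Y [aY [eta [[hY _ [Z [c [zeta [[hc zreg isoZ] [_ zst walkZ]]]]]] freeY]]]]] := hB.
move=> [K [b [nuK [[hb _ isoK] hK]]]].
have [f [h [[mf mh] fnu hf _ fe]]] := isoK.
have [f' [h' [[mf' mh'] fnu' hf' _ fe']]] := isoZ.
have [dO [W [P [xi [hxi xi_cvg]]]]] := walkZ.
apply: (boundary_vanishing hG hmu hc zst zreg phi01 phiJ _ hxi xi_cvg).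
  move=> k B mB; have mf'B : measurable (f' @^-1` B).
    by rewrite -[X in measurable X]setTI; exact: mf'.
  (* A Borel set of [Z] is pulled back to [Y] along [f'] and then to [K] along [h]. These maps are
     merely measurable, which is why the bound on [K] is stated for all Borel sets. *)
  have := fixpoint_bound hmu phi1 phi01 hp pst hb hK k
    (B := (h @^-1` (f' @^-1` B) : set (borel K))).
  rewrite preimage_setC (model_lift mf mh fnu hf (measurableC mf'B)).
  rewrite (model_lift_action hY hb mf mh fnu hf fe k mf'B).
  rewrite preimage_setC -(model_fprob fnu' (measurableC mB)).
  rewrite -(model_fprob_action hY hc mf' fnu' fe' k mB).
  by apply; rewrite -[X in measurable X]setTI; exact: mh.
exact: (fixpoints_null hY hc mf' fnu' hf' fe' freeY g1).
Qed.
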